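(* Let $n\ge 2$, let $(v,x)\in\mathfrak{N}$ with $\mathrm{eType}(v,x)=((n-1,1),\varnothing)$, and let $2\le i\le n$. Then there is an isomorphism of varieties $\overline{C_n^i}\simeq\Sigma_{-1}$.
   Context: All varieties are over $\mathbb{C}$. Let $U$ be an $n$-dimensional complex vector space and $V=U\oplus U^*$ with the symplectic form $\langle (u,f),(u',f')\rangle=f'(u)-f(u')$; $W^\perp$ denotes the perpendicular space of $W$. Let $\mathcal{S}=\{x\in\mathrm{End}(V): \langle xv,w\rangle=\langle v,xw\rangle\ \forall v,w\in V\}$. The exotic nilpotent cone is $\mathfrak{N}=\{(v,x): v\in V,\ x\in\mathcal{S},\ x \text{ nilpotent}\}$; the same definitions apply to any finite-dimensional symplectic space. Exotic type. A bipartition of $n$ is a pair $(\mu,\nu)$ of partitions with $|\mu|+|\nu|=n$; let $\lambda=\mu+\nu$ (partwise sum) and $\ell(\cdot)$ be the number of nonzero parts. One writes $\mathrm{eType}(v,x)=(\mu,\nu)$ iff $V$ has a basis $\{v_{ij},v_{ij}^*: 1\le i\le \ell(\lambda),1\le j\le \lambda_i\}$ with $\langle v_{ij},v^*_{i'j'}\rangle=\delta_{ii'}\delta_{jj'}$, $\langle v_{ij},v_{i'j'}\rangle=\langle v^*_{ij},v^*_{i'j'}\rangle=0$, $v=\sum_{i=1}^{\ell(\mu)}v_{i,\mu_i}$, $xv_{ij}=v_{i,j-1}$ (zero if $j=1$), $xv^*_{ij}=v^*_{i,j+1}$ (zero if $j=\lambda_i$). Every $(v,x)\in\mathfrak{N}$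 has a unique exotic type. Exotic Springer fibre. $\mathcal{C}_{(v,x)}$ is the variety of complete flags $F_\bullet=(0=F_0\subset F_1\subset\dots\subset F_{2n}=V)$, $\dim F_i=i$, with $F_i^\perp=F_{2n-i}$, $v\in F_n$, and $x(F_i)\subseteq F_{i-1}$ for all $i\ge1$. For $0\le k\le n$ put $\Phi^k(F_\bullet)=\mathrm{eType}(v+F_k,x|_{F_k^\perp/F_k})$, a bipartition of $n-k$, computed in the symplectic space $F_k^\perp/F_k$. For a standard bitableau $T$ with $n$ boxes (a pair of tableaux filled with $1,\dots,n$, each used once, increasing along rows and down columns), $\Phi^{-1}(T)$ is the set of $F_\bullet\in\mathcal{C}_{(v,x)}$ such that for every $0\le k\le n$, $\Phi^{n-k}(F_\bullet)$ is the shape formed by the entries $\le k$ of $T$. For $2\le i\le n$, let $T_n^i$ be the standard bitableau of shape $((n-1,1),\varnothing)$ with $\{1,\dots,n\}\setminus\{i\}$ in the first row and $i$ in the second row. Put $C_n^i=\Phi^{-1}(T_n^i)$, and let $\overline{C_n^i}$ be its closure in $\mathcal{C}_{(v,x)}$. For $m>0$, $\Sigma_{-m}$ denotes the $\mathbb{P}^1$-bundle over $\mathbb{P}^1$ obtained by projectivising fibrewise (taking lines in fibres) the rank-two vector bundle $\mathcal{O}\oplus\mathcal{O}(-m)$ over $\mathbb{P}^1$. *)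

(* Defs.v *)
From HB Require Import structures.
From mathcomp Require Import all_boot all_order all_algebra.
From mathcomp Require Import mpoly.
From mathcomp Require Import classical_sets reals complex.

Set Implicit Arguments.
Unset Strict Implicit.
Unset Printing Implicit Defensive.

Import GRing.Theory.

Local Open Scope classical_set_scope.
Local Open Scope ring_scope.

(** * Varieties as spaces with functions

  A variety is handled classically, as a set of closed points with its Zariski
  open subsets and the regular K-valued functions on them.  The points form a
  subset [pts] of an ambient type [T]; [regfun X A f] says that the
  restriction of [f] to the open set [A] is regular, the values of [f] outside
  [A] being irrelevant. *)

Record fspace (K T : Type) := FSpace {
  pts : set T;
  zopen : set (set T);
  regfun : set T -> set (T -> K) }.

Definition regular_map (K T1 T2 : Type) (X : fspace K T1) (Y : fspace K T2)
    (f : T1 -> T2) : Prop :=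
  (forall a, pts X a -> pts Y (f a)) /\
  (forall B, zopen Y B ->
    zopen X (pts X `&` f @^-1` B) /\
    forall g, regfun Y B g -> regfun X (pts X `&` f @^-1` B) (g \o f)).

Definition isomorphic (K T1 T2 : Type) (X : fspace K T1) (Y : fspace K T2) :
    Prop :=
  exists (f : T1 -> T2) (g : T2 -> T1),
    [/\ regular_map X Y f, regular_map Y X g,
        forall a, pts X a -> g (f a) = a &
        forall b, pts Y b -> f (g b) = b].

Definition zclosure (K T : Type) (X : fspace K T) (A : set T) : set T :=
  [set a | pts X a /\ forall B, zopen X B -> B a -> exists2 b, B b & A b].

(* A subset with the induced topology, its regular functions being those that
   extend locally to regular functions of X (the reduced structure when Z is
   locally closed). *)
Definition sub_variety (K T : Type) (X : fspace K T) (Z : set T) : fspace K T :=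
  {| pts := pts X `&` Z;
     zopen := [set A | exists2 B, zopen X B & A = B `&` Z];
     regfun := fun A => [set f | forall a, A a ->
       exists B g, [/\ zopen X B, B a, regfun X B g &
                       forall b, A b -> B b -> f b = g b]] |}.

Definition quotient_variety (K T T' : Type) (X : fspace K T) (p : T -> T') :
    fspace K T' :=
  {| pts := p @` pts X;
     zopen := [set A | A `<=` p @` pts X /\ zopen X (pts X `&` p @^-1` A)];
     regfun := fun A => [set f : T' -> K |
       regfun X (pts X `&` p @^-1` A) (f \o p)] |}.

(* The value at w of a polynomial in the coordinates of W. *)
Definition peval (K : fieldType) (W : vectType K) (p : {mpoly K[\dim {:W}]})
    (w : W) : K :=
  p.@[fun j => coord (vbasis {:W}) j w].

Definition affine (K : fieldType) (W : vectType K) : fspace K W :=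
  let op : set (set W) := [set A | exists S : set {mpoly K[\dim {:W}]},
    A = [set w | exists2 p, S p & peval p w != 0]] in
  {| pts := setT;
     zopen := op;
     regfun := fun A => [set f | forall a, A a ->
       exists B (p q : {mpoly K[\dim {:W}]}), [/\ op B, B a, B `<=` A &
         forall b, B b -> peval q b != 0 /\ f b = peval p b / peval q b]] |}.

(** * The surfaces Sigma_{-m} *)

(* P(W1) x P(W2) *)
Definition biproj (K : fieldType) (W1 W2 : vectType K) :
    fspace K ({vspace W1} * {vspace W2}) :=
  quotient_variety
    (sub_variety (affine (W1 * W2)%type) [set w | w.1 != 0 /\ w.2 != 0])
    (fun w => (<[w.1]>%VS, <[w.2]>%VS)).

(* O(-m) is the m-th tensor power of the tautological line bundle O(-1) of
   P^1.  It is a subbundle of the trivial bundle with fibre Sym^m(K^2): its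
   fibre over the line spanned by u is the line spanned by u^m, whose
   coordinates are the monomials of degree m in those of u. *)
Definition power_vec (K : fieldType) (m : nat) (u : 'rV[K]_2) : 'rV[K]_m.+1 :=
  \row_(j < m.+1) (u 0 ord0 ^+ (m - j) * u 0 ord_max ^+ j).

(* The fibre of O + O(-m) over the line spanned by u. *)
Definition bundle_fibre (K : fieldType) (m : nat) (u : 'rV[K]_2) :
    {vspace (K^o * 'rV[K]_m.+1)%type} :=
  let s : (K^o * 'rV[K]_m.+1)%type := (1, 0%R) in
  let t : (K^o * 'rV[K]_m.+1)%type := (0%R, power_vec m u) in
  (<[s]> + <[t]>)%VS.

Definition Sigma_neg (K : fieldType) (m : nat) :
    fspace K ({vspace 'rV[K]_2} * {vspace (K^o * 'rV[K]_m.+1)%type}) :=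
  sub_variety (biproj 'rV[K]_2 (K^o * 'rV[K]_m.+1)%type)
    [set l | exists2 u, u != 0 &
       l.1 = <[u]>%VS /\ (l.2 <= bundle_fibre m u)%VS].

(** * Exotic types *)

(* Partitions are weakly decreasing sequences of positive integers; the size of
   the sequence is the length of the partition. *)
Definition is_partition (mu : seq nat) : bool :=
  sorted geq mu && (0 \notin mu)%N.

(* Parts are numbered from 1. *)
Definition part (mu : seq nat) (i : nat) : nat := nth 0%N mu i.-1.

Definition is_bipartition (n : nat) (mn : seq nat * seq nat) : bool :=
  [&& is_partition mn.1, is_partition mn.2 & (sumn mn.1 + sumn mn.2 == n)%N].

Definition psum (mu nu : seq nat) : seq nat :=
  mkseq (fun i => nth 0%N mu i + nth 0%N nu i)%N (maxn (size mu) (size nu)).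

Definition cells (la : seq nat) : seq (nat * nat) :=
  [seq (i, j) | i <- iota 1 (size la), j <- iota 1 (part la i)].

(* [eType w v x mn]: the pair (v, x) has exotic type mn in the space E with
   symplectic form w. *)
Definition eType (K : fieldType) (E : vectType K) (w : E -> E -> K) (v : E)
    (x : E -> E) (mn : seq nat * seq nat) : Prop :=
  let la := psum mn.1 mn.2 in
  is_bipartition (\dim {:E})./2 mn /\
  exists b bs : nat -> nat -> E,
    [/\ basis_of {:E} ([seq b c.1 c.2 | c <- cells la] ++
                       [seq bs c.1 c.2 | c <- cells la]),
        {in cells la &, forall c d,
          [/\ w (b c.1 c.2) (bs d.1 d.2) = (c == d)%:R,
              w (b c.1 c.2) (b d.1 d.2) = 0 &
              w (bs c.1 c.2) (bs d.1 d.2) = 0]},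
        v = \sum_(1 <= i < (size mn.1).+1) b i (part mn.1 i) &
        {in cells la, forall c,
          x (b c.1 c.2) = (if c.2 == 1%N then 0 else b c.1 c.2.-1) /\
          x (bs c.1 c.2) =
            (if c.2 == part la c.1 then 0 else bs c.1 c.2.+1)}].

(** * The symplectic space V = U + U^* and the exotic nilpotent cone *)

Definition symp_space (K : fieldType) (U : vectType K) : vectType K :=
  (U * 'Hom(U, K^o))%type.

Definition symp (K : fieldType) (U : vectType K) (a b : symp_space U) : K :=
  b.2 a.1 - a.2 b.1.

Lemma symp_linear (K : fieldType) (U : vectType K) (a : symp_space U) :
  linear (symp a : symp_space U -> K^o).
Proof.
move=> k b c; rewrite /symp /= add_lfunE scale_lfunE linearP /=.
by rewrite scalerBr opprD addrACA.
Qed.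

Definition perp (K : fieldType) (U : vectType K) (W : {vspace symp_space U}) :
    {vspace symp_space U} :=
  (\bigcap_(a <- vbasis W) lker (linfun (symp a : symp_space U -> K^o)))%VS.

Lemma sympC (K : fieldType) (U : vectType K) (a b : symp_space U) :
  symp a b = - symp b a.
Proof. by rewrite /symp opprB. Qed.

Lemma perpP (K : fieldType) (U : vectType K) (W : {vspace symp_space U})
    (b : symp_space U) :
  b \in perp W <-> (forall a, a \in W -> symp a b = 0).
Proof.
have linE (a : symp_space U) :
    linfun (symp a : symp_space U -> K^o) b = symp a b.
  pose L := GRing.isLinear.Build K (symp_space U) K^o *:%R
    (symp a : symp_space U -> K^o) (@symp_linear K U a).
  pose f : {linear symp_space U -> K^o} :=
    HB.pack (symp a : symp_space U -> K^o) L.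
  exact: (lfunE f b).
have memE (s : seq (symp_space U)) :
    b \in (\bigcap_(a <- s) lker (linfun (symp a : symp_space U -> K^o)))%VS =
    all (fun a => symp a b == 0) s.
  elim: s => [|a s IHs]; first by rewrite big_nil memvf.
  by rewrite big_cons memv_cap memv_ker linE IHs.
rewrite /perp memE; split=> [/allP Wb a Wa | Wb]; last first.
  by apply/allP=> a /vbasis_mem/Wb ->.
rewrite sympC (coord_vbasis Wa).
rewrite -[symp _ _]/((symp b : symp_space U -> K^o) _).
pose L := GRing.isLinear.Build K (symp_space U) K^o *:%R
  (symp b : symp_space U -> K^o) (@symp_linear K U b).
pose f : {linear symp_space U -> K^o} :=
  HB.pack (symp b : symp_space U -> K^o) L.
rewrite -[symp b]/(f : _ -> _) linear_sum big1 ?oppr0 // => i _.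
rewrite linearZ /= sympC (eqP (Wb _ _)) ?oppr0 ?scaler0 //.
by rewrite mem_nth // size_tuple.
Qed.

Definition in_S (K : fieldType) (U : vectType K) (x : 'End(symp_space U)) :
    Prop :=
  forall a b, symp (x a) b = symp a (x b).

Definition nilpotent_end (K : fieldType) (V : vectType K) (x : 'End(V)) : Prop :=
  exists k, forall a, iter k x a = 0.

Definition exotic_nilcone (K : fieldType) (U : vectType K) :
    set (symp_space U * 'End(symp_space U)) :=
  [set vx | in_S vx.2 /\ nilpotent_end vx.2].

(** * Exotic Springer fibres *)

(* A flag is the sequence of its members; F_i is [fl F i]. *)
Definition fl (K : fieldType) (V : vectType K) (F : seq {vspace V}) (i : nat) :
  {vspace V} := nth 0%VS F i.

Definition complete_flag (K : fieldType) (V : vectType K)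
    (F : seq {vspace V}) : Prop :=
  [/\ size F = (\dim {:V}).+1,
      forall i, (i <= \dim {:V})%N -> \dim (fl F i) = i &
      forall i, (i < \dim {:V})%N -> (fl F i <= fl F i.+1)%VS].

Definition flag_of_frame (K : fieldType) (V : vectType K)
    (e : {ffun 'I_(\dim {:V}) -> V}) : seq {vspace V} :=
  mkseq (fun i => <<take i (codom e)>>%VS) (\dim {:V}).+1.

(* The variety of complete flags, with its structure of homogeneous space
   GL(V)/B: ordered bases modulo spanning the same flag. *)
Definition flag_variety (K : fieldType) (V : vectType K) :
    fspace K (seq {vspace V}) :=
  quotient_variety
    (sub_variety (affine {ffun 'I_(\dim {:V}) -> V}) [set e | free (codom e)])
    (@flag_of_frame K V).

Definition springer_fibre (K : fieldType) (U : vectType K) (v : symp_space U)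
    (x : 'End(symp_space U)) : fspace K (seq {vspace symp_space U}) :=
  let n := \dim {:U} in
  sub_variety (flag_variety (symp_space U))
    [set F | [/\ complete_flag F,
        forall i, (i <= n.*2)%N -> perp (fl F i) = fl F (n.*2 - i)%N,
        v \in fl F n &
        forall i, (1 <= i <= n.*2)%N -> (x @: fl F i <= fl F i.-1)%VS]].

(* The quotient W / L, for L contained in W, is realised on the complement
   W :\: L of L in W; [quot_class] is then the canonical map on W, and [vsval]
   chooses representatives. *)
Definition quot (K : fieldType) (V : vectType K) (W L : {vspace V}) :
    vectType K := subvs_of (W :\: L)%VS.

Definition quot_class (K : fieldType) (V : vectType K) (W L : {vspace V})
    (a : V) : quot W L := vsproj (W :\: L)%VS (addv_pi1 W L a).

Lemma quot_class_linear (K : fieldType) (V : vectType K) (W L : {vspace V}) :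
  linear (@quot_class K V W L).
Proof. by move=> k a b; rewrite /quot_class !linearP. Qed.

Lemma vsval_quotK (K : fieldType) (V : vectType K) (W L : {vspace V})
    (q : quot W L) : quot_class W L (vsval q) = q.
Proof.
by rewrite /quot_class /addv_pi1 daddv_pi_id ?capv_diff ?subvsP ?vsvalK.
Qed.

Lemma quot_class_eq0 (K : fieldType) (V : vectType K) (W L : {vspace V})
    (a : V) :
  a \in W -> (quot_class W L a == 0) = (a \in L).
Proof.
move=> Wa; have WLa : a \in (W + L)%VS by rewrite (subvP (addvSl W L)).
have /addv_pi1_pi2 aE := WLa.
rewrite /quot_class; apply/eqP/idP => [a0 | La]; last first.
  suff -> : addv_pi1 W L a = 0 by rewrite linear0.
  by apply: (addIr (addv_pi2 W L a)); rewrite aE add0r addv_pi2_id.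
have p0 : addv_pi1 W L a = 0.
  by rewrite -(vsprojK (memv_pi (W :\: L) L a)) [vsproj _ _]a0 linear0.
by rewrite -aE p0 add0r memv_pi2.
Qed.

(* [Phi x v F k mn]: Phi^k(F) = mn. *)
Definition Phi (K : fieldType) (U : vectType K) (v : symp_space U)
    (x : 'End(symp_space U)) (F : seq {vspace symp_space U}) (k : nat)
    (mn : seq nat * seq nat) : Prop :=
  let Q := quot (perp (fl F k)) (fl F k) in
  let cl := quot_class (perp (fl F k)) (fl F k) in
  eType (fun a b : Q => symp (vsval a) (vsval b)) (cl v)
        (fun a : Q => cl (x (vsval a))) mn.

(** * Standard bitableaux *)

(* A tableau is the sequence of its rows. *)
Definition tableau := seq (seq nat).

Definition shape_upto (k : nat) (t : tableau) : seq nat :=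
  [seq s <- [seq count (leq^~ k) r | r <- t] | (0 < s)%N].

Definition Phi_inv (K : fieldType) (U : vectType K) (v : symp_space U)
    (x : 'End(symp_space U)) (T : tableau * tableau) :
    set (seq {vspace symp_space U}) :=
  let n := \dim {:U} in
  [set F | pts (springer_fibre v x) F /\
     forall k, (k <= n)%N ->
       Phi v x F (n - k)%N (shape_upto k T.1, shape_upto k T.2)].

Definition tab (n i : nat) : tableau * tableau :=
  ([:: [seq j <- iota 1 n | j != i]; [:: i]], [::]).

Definition C_var (K : fieldType) (U : vectType K) (v : symp_space U)
    (x : 'End(symp_space U)) (i : nat) : set (seq {vspace symp_space U}) :=
  Phi_inv v x (tab (\dim {:U}) i).

(* Main.v *)
(* Put N = n - 1, k = n + 1 - i and E_j = x^{N-j} v.  Every F in the fibre contains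
   E_{j-1} in F_j, and F_n is spanned by E_1, .., E_N and a vector h of a fixed
   2-dimensional space <f, fs> killed by x.  The flags with F_{k-1} =
   <E_1 .. E_{k-1}> and F_{k+1} = F_{k-1} + <E_k, h> are determined by the line <h>
   and by the line F_k / F_{k-1} in <E_k> + <h>; as h runs over <f, fs> these data
   form P(O + O(-1)).  By the exotic types of the quotients F_j^perp / F_j, such a
   flag lies in C exactly when E_k is not in F_k; the remaining flags are limits of
   those.  Regularity of the bijection and of its inverse is checked on frames: the
   lines are given by minors of the frame, and conversely explicit symplectic frames
   depend polynomially on representatives of the two lines. *)

(* The index k is where the box i disappears: [Phi] at step j has hook shape exactly for j < k.
   Shapes (m-1, 1) and (m) are told apart by whether x^{m-1} kills the vector. At steps k-1 and k
   this gives E_{k-1} in F_{k-1} and E_k outside F_k, from which the description of F_{k-1} and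
   F_{k+1} follows.

   The closure is caught from both sides: linear conditions on members of a flag survive in the
   closure, and each flag satisfying them but lying outside C is the value at t = 0 of a polynomial
   curve of frames whose flags lie in C for t nonzero.

   The formulas are shaped by the definition of regular functions: on a subvariety they are local
   restrictions from the ambient quotient, so a lift must exist and descend also off the subvariety.
   Hence the frames stay symplectic where the incidence of the two lines fails, and the minor
   vectors are controlled for all flags.

   Since the line in <E_k> + <h> has its <f, fs>-component in <h>, the surface is the blow-up of the
   plane P(<E_k, f, fs>) at the point [E_k]; the exceptional curve corresponds to the flags outside
   C. *)
Require Import Defs.
From HB Require Import structures.
From mathcomp Require Import all_boot all_order all_algebra.
From mathcomp Require Import mpoly.
From mathcomp Require Import boolp classical_sets reals complex.
From mathcomp Require Import ring zify.

Set Implicit Arguments.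
Unset Strict Implicit.
Unset Printing Implicit Defensive.

Import Order.TTheory GRing.Theory Num.Theory.

Local Open Scope classical_set_scope.
Local Open Scope ring_scope.

(** * Polynomial maps *)

Section PolynomialMaps.
Variable K : fieldType.
Implicit Types W V : vectType K.

Definition polyfun W (s : W -> K) : Prop :=
  exists p : {mpoly K[\dim {:W}]}, forall w, s w = peval p w.

(** Testing against every linear functional avoids coordinates on the target, so composing with a
    linear map costs nothing. *)
Definition polymap W V (s : W -> V) : Prop :=
  forall l : 'Hom(V, K^o), polyfun (fun w => l (s w)).

Lemma polyfun_ext W (s t : W -> K) : s =1 t -> polyfun s -> polyfun t.
Proof. by move=> st [p ps]; exists p => w; rewrite -st. Qed.

Lemma polyfun_cst W (c : K) : polyfun (fun _ : W => c).
Proof. by exists c%:MP => w; rewrite /peval mevalC. Qed.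

Lemma polyfunD W (s t : W -> K) :
  polyfun s -> polyfun t -> polyfun (fun w => s w + t w).
Proof. by move=> [p ps] [q qt]; exists (p + q) => w; rewrite /peval mevalD ps qt. Qed.

Lemma polyfunM W (s t : W -> K) :
  polyfun s -> polyfun t -> polyfun (fun w => s w * t w).
Proof. by move=> [p ps] [q qt]; exists (p * q) => w; rewrite /peval mevalM ps qt. Qed.

Lemma polyfunN W (s : W -> K) : polyfun s -> polyfun (fun w => - s w).
Proof. by move=> [p ps]; exists (- p) => w; rewrite /peval mevalN ps. Qed.

Lemma polyfun_sum W (I : finType) (s : I -> W -> K) :
  (forall i, polyfun (s i)) -> polyfun (fun w => \sum_i s i w).
Proof.
move=> ps; elim: index_enum => [|i r IHr].
  by apply: polyfun_ext (polyfun_cst W 0) => w; rewrite big_nil.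
by apply: polyfun_ext (polyfunD (ps i) IHr) => w; rewrite big_cons.
Qed.

Lemma polyfun_prod W (I : finType) (s : I -> W -> K) :
  (forall i, polyfun (s i)) -> polyfun (fun w => \prod_i s i w).
Proof.
move=> ps; elim: index_enum => [|i r IHr].
  by apply: polyfun_ext (polyfun_cst W 1) => w; rewrite big_nil.
by apply: polyfun_ext (polyfunM (ps i) IHr) => w; rewrite big_cons.
Qed.

Lemma polyfun_det W m (s : W -> 'M[K]_m) :
  (forall i j, polyfun (fun w => s w i j)) -> polyfun (fun w => \det (s w)).
Proof.
move=> ps; apply: polyfun_sum => t; apply: polyfunM; first exact: polyfun_cst.
by apply: polyfun_prod => i; apply: ps.
Qed.

Lemma polyfun_linear W (l : 'Hom(W, K^o)) : polyfun l.
Proof.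
pose p : {mpoly K[\dim {:W}]} :=
  \sum_(j < \dim {:W}) (l (vbasis {:W})`_j : K) *: 'X_j.
exists p => w; rewrite {1}(coord_vbasis (memvf w)) linear_sum /=.
rewrite /peval /p (raddf_sum (meval _)) /=; apply: eq_bigr => j _.
by rewrite linearZ /= mevalZ mevalXU mulrC.
Qed.

Lemma polymap_id W : polymap (@id W).
Proof. by move=> l; apply: polyfun_linear. Qed.

Lemma polymap_cst W V (a : V) : polymap (fun _ : W => a).
Proof. by move=> l; apply: polyfun_cst. Qed.

Lemma polymapD W V (s t : W -> V) :
  polymap s -> polymap t -> polymap (fun w => s w + t w).
Proof.
move=> ps pt l; apply: polyfun_ext (polyfunD (ps l) (pt l)) => w.
by rewrite linearD.
Qed.

Lemma polymap_sum W V (I : finType) (s : I -> W -> V) :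
  (forall i, polymap (s i)) -> polymap (fun w => \sum_i s i w).
Proof.
move=> ps l; apply: polyfun_ext (polyfun_sum (fun i => ps i l)) => w.
by rewrite linear_sum.
Qed.

Lemma polymapZ W V (c : W -> K) (s : W -> V) :
  polyfun c -> polymap s -> polymap (fun w => c w *: s w).
Proof.
move=> pc ps l; apply: polyfun_ext (polyfunM pc (ps l)) => w.
by rewrite linearZ.
Qed.

Lemma polymap_linear W V V' (L : 'Hom(V, V')) (s : W -> V) :
  polymap s -> polymap (fun w => L (s w)).
Proof.
move=> ps l; apply: polyfun_ext (ps (l \o L)%VF) => w.
by rewrite comp_lfunE.
Qed.

Lemma linfunE W V (g : W -> V) : linear g -> linfun g =1 g.
Proof.
move=> gL w; pose h : {linear W -> V} :=
  HB.pack g (GRing.isLinear.Build K W V *:%R g gL).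
exact: (lfunE h w).
Qed.

Lemma polymap_pair W V V' (s : W -> V) (t : W -> V') :
  polymap s -> polymap t -> polymap (fun w => (s w, t w) : (V * V')%type).
Proof.
move=> ps pt l.
have L1 : linear (fun a : V => (a, 0) : (V * V')%type).
  by move=> c a b; congr (_, _); rewrite /= scaler0 addr0.
have L2 : linear (fun a : V' => (0, a) : (V * V')%type).
  by move=> c a b; congr (_, _); rewrite /= scaler0 addr0.
pose H1 := polymap_linear (linfun (fun a : V => (a, 0) : (V * V')%type)) ps.
pose H2 := polymap_linear (linfun (fun a : V' => (0, a) : (V * V')%type)) pt.
apply: polyfun_ext (polymapD H1 H2 l) => w; congr (l _).
by rewrite !linfunE //; congr (_, _); rewrite /= ?addr0 ?add0r.
Qed.

Lemma polymap_ffun W V m (s : 'I_m -> W -> V) :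
  (forall i, polymap (s i)) -> polymap (fun w => [ffun i => s i w]).
Proof.
move=> ps.
pose g (i : 'I_m) (a : V) : {ffun 'I_m -> V} := [ffun j => if j == i then a else 0].
have gL i : linear (g i).
  move=> c a b; apply/ffunP => j; rewrite !ffunE.
  by case: ifP; rewrite ?scaler0 ?addr0.
have H i := polymap_linear (linfun (g i)) (ps i).
move=> l; apply: polyfun_ext (polymap_sum H l) => w; congr (l _).
apply/ffunP => j; rewrite sum_ffunE ffunE (bigD1 j) //=.
rewrite big1 ?addr0 => [|i /negPf ij]; rewrite linfunE // ffunE ?eqxx //.
by rewrite eq_sym ij.
Qed.

Lemma polyfun_entry W m p (s : W -> 'M[K]_(m, p)) i j :
  polymap s -> polyfun (fun w => s w i j).
Proof.
move=> ps; have L : linear (fun A : 'M[K]_(m, p) => A i j : K^o).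
  by move=> c A B; rewrite !mxE.
by apply: polyfun_ext (ps (linfun (fun A : 'M[K]_(m, p) => A i j : K^o))) => w; rewrite linfunE.
Qed.

Lemma polyfun_comp W V (s : W -> V) (q : V -> K) :
  polyfun q -> polymap s -> polyfun (fun w => q (s w)).
Proof.
move=> [p pq] ps.
have sj j : exists r : {mpoly K[\dim {:W}]}, forall w,
    coord (vbasis {:V}) j (s w) = peval r w.
  have L : linear (coord (vbasis {:V}) j : V -> K^o).
    by move=> c a b; rewrite linearP.
  have [r rE] := ps (linfun (coord (vbasis {:V}) j : V -> K^o)).
  by exists r => w; rewrite -rE linfunE.
have [r rE] := choice sj.
exists (p \mPo [tuple r j | j < \dim {:V}]) => w.
rewrite pq /peval comp_mpoly_meval; apply: meval_eq => j.
by rewrite tnth_mktuple rE.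
Qed.

(** Used to restrict an open condition to a curve. The chosen basis vector of [K^o] need not be 1,
    so the coordinate of t is t times the coordinate of 1. *)
Lemma polyfun_line (r : K^o -> K) : polyfun r ->
  exists p : {poly K}, forall t, r t = p.[t].
Proof.
move=> [q qr].
exists (\sum_(m <- msupp q) (q@_m)%:P *
  \prod_i ((coord (vbasis {:K^o}) i 1)%:P * 'X) ^+ m i).
move=> t; rewrite qr /peval mevalE horner_sum; apply: eq_bigr => m _.
rewrite hornerM hornerC horner_prod; congr (_ * _); apply: eq_bigr => i _.
rewrite horner_exp hornerM hornerC hornerX; congr (_ ^+ _).
have -> : t = t *: (1 : K^o) by rewrite /GRing.scale /= mulr1.
by rewrite linearZ /= mulrC /GRing.scale /= mulr1.
Qed.

End PolynomialMaps.

(** * Sub- and quotient varieties *)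

Section Topology.
Variable K : fieldType.
Implicit Types W V : vectType K.

Lemma affine_openP W (A : set W) : zopen (affine W) A <->
  forall a, A a -> exists2 q, polyfun q & q a != 0 /\ forall b, q b != 0 -> A b.
Proof.
split=> [[S ->] a [p Sp pa] | H].
  exists (peval p); first by exists p.
  by split=> // b pb; exists p.
exists [set p | forall b, peval p b != 0 -> A b].
apply/seteqP; split=> [a /H [q [p pq] [qa qA]] | a [p pA pa]]; last exact: pA.
by exists p; rewrite -?pq // => b; rewrite -pq; apply: qA.
Qed.

Lemma affine_regP W (A : set W) (f : W -> K) : regfun (affine W) A f <->
  forall a, A a -> exists d p q, [/\ polyfun d, polyfun p, polyfun q, d a != 0 &
    forall b, d b != 0 -> [/\ A b, q b != 0 & f b = p b / q b]].
Proof.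
split=> [H a Aa | H /= a Aa].
  have [B [p [q [oB Ba BA pq]]]] := H a Aa.
  have [d pd [da dB]] := (affine_openP B).1 oB a Ba.
  exists d, (peval p), (peval q); split=> //; first by exists p.
    by exists q.
  by move=> b /dB Bb; have [] := pq b Bb; split=> //; apply: BA.
have [d [p [q [pd [p' pE] [q' qE] da H']]]] := H a Aa.
exists [set b | d b != 0], p', q'; split=> //.
- by apply/affine_openP => b db; exists d.
- by move=> b /H' [].
- by move=> b /H' []; rewrite pE qE.
Qed.

(** [fspace] carries no axioms; these are the two properties needed to flatten a subvariety of a
    subvariety. *)
Definition restrictable (T : Type) (X : fspace K T) : Prop :=
  (forall A B, zopen X A -> zopen X B -> zopen X (A `&` B)) /\
  (forall A B g, zopen X A -> zopen X B -> A `<=` B -> regfun X B g ->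
     regfun X A g).

Lemma affine_restrictable W : restrictable (affine W).
Proof.
split=> [A B /affine_openP oA /affine_openP oB|].
  apply/affine_openP => a [Aa Ba].
  have [q pq [qa qA]] := oA _ Aa; have [r pr [ra rB]] := oB _ Ba.
  exists (fun w => q w * r w); first exact: polyfunM.
  rewrite mulf_neq0 //; split=> // b; rewrite mulf_eq0 negb_or => /andP[qb rb].
  by split; [apply: qA | apply: rB].
move=> A B g /affine_openP oA oB AB /affine_regP gB; apply/affine_regP => a Aa.
have [d [p [q [pd pp pq da H]]]] := gB a (AB _ Aa).
have [r pr [ra rA]] := oA _ Aa.
exists (fun w => d w * r w), p, q; split=> //; first exact: polyfunM.
  by rewrite mulf_neq0.
move=> b; rewrite mulf_eq0 negb_or => /andP[db rb].
by have [_ ? ?] := H b db; split=> //; apply: rA.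
Qed.

Lemma sub_restrictable T (X : fspace K T) (Z : set T) :
  restrictable X -> restrictable (sub_variety X Z).
Proof.
move=> [XI Xr]; split=> [A B [A1 oA ->] [B1 oB ->] | A B g oA oB AB gB /= a Aa].
  by exists (A1 `&` B1); [apply: XI | rewrite setIACA setIid].
have [C [h [oC Ca hC gh]]] := gB a (AB _ Aa).
by exists C, h; split=> // b Ab Cb; apply: gh => //; apply: AB.
Qed.

Lemma quotient_restrictable T T' (X : fspace K T) (p : T -> T') :
  restrictable X -> restrictable (quotient_variety X p).
Proof.
move=> [XI Xr]; split=> [A B [Ap oA] [Bp oB] | A B g [Ap oA] [Bp oB] AB gB].
  split=> [a [/Ap] //|]; rewrite preimage_setI.
  by rewrite -[pts X]setIid setIACA; apply: XI.
by apply: (Xr _ _ _ oA oB _ gB) => w [Xw /AB].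
Qed.

Lemma regular_map_comp T1 T2 T3 (X : fspace K T1) (Y : fspace K T2)
    (Z : fspace K T3) (f : T1 -> T2) (g : T2 -> T3) :
  regular_map X Y f -> regular_map Y Z g -> regular_map X Z (g \o f).
Proof.
move=> [fp fr] [gp gr]; split=> [a /fp /gp // | B oB].
have [ogB grB] := gr B oB; have [ofB frB] := fr _ ogB.
have E : pts X `&` (g \o f) @^-1` B = pts X `&` f @^-1` (pts Y `&` g @^-1` B).
  apply/seteqP; split=> a [Xa Ba]; split=> //; first by split=> //; apply: fp.
  by case: Ba.
by rewrite E; split=> // h /grB /frB.
Qed.

(** The closure is a subvariety of the Springer fibre, itself a subvariety of the flag variety,
    whereas the lifting criterion speaks of a single subvariety of a quotient. This map and
    [sub_regular_sub] pass between the two presentations. *)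
Lemma sub_sub_regular T (X : fspace K T) (Z1 Z2 : set T) :
  (forall B, zopen X B -> B `<=` pts X) ->
  regular_map (sub_variety (sub_variety X Z1) Z2)
    (sub_variety X (Z1 `&` Z2)) id.
Proof.
move=> Xp; split=> [a [[Xa Z1a] Z2a] // | B [B1 oB ->]].
have E : pts (sub_variety (sub_variety X Z1) Z2) `&` id @^-1` (B1 `&` (Z1 `&` Z2))
    = B1 `&` Z1 `&` Z2.
  by apply/seteqP; split=> a; have := Xp _ oB a; rewrite /preimage /=; tauto.
rewrite E; split; first by exists (B1 `&` Z1) => //; exists B1.
move=> g gB /= a [[B1a Z1a] Z2a].
have [C [h [oC Ca hC gh]]] : exists C h, [/\ zopen X C, C a, regfun X C h &
    forall b, (B1 `&` (Z1 `&` Z2)) b -> C b -> g b = h b] by apply: gB.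
exists (C `&` Z1), h; split=> //; first by exists C.
  by move=> c [Cc _]; exists C, h.
by move=> b [[? ?] ?] [Cb _]; apply: gh.
Qed.

Lemma sub_regular_sub T (X : fspace K T) (Z1 Z2 : set T) : restrictable X ->
  (forall B, zopen X B -> B `<=` pts X) ->
  regular_map (sub_variety X (Z1 `&` Z2))
    (sub_variety (sub_variety X Z1) Z2) id.
Proof.
move=> [XI Xr] Xp; split=> [a [Xa [Z1a Z2a]] // | B [_ [B1 oB ->] ->]].
have E : pts (sub_variety X (Z1 `&` Z2)) `&` id @^-1` (B1 `&` Z1 `&` Z2)
    = B1 `&` (Z1 `&` Z2).
  by apply/seteqP; split=> a; have := Xp _ oB a; rewrite /preimage /=; tauto.
rewrite E; split; first by exists B1.
move=> g gB /= a [B1a [Z1a Z2a]].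
have [_ [h [[C oC ->] [Ca _] hC gh]]] : exists C h,
  [/\ zopen (sub_variety X Z1) C, C a, regfun (sub_variety X Z1) C h &
    forall b, (B1 `&` Z1 `&` Z2) b -> C b -> g b = h b] by apply: gB.
have [D [h' [oD Da hD hh']]] := hC a (conj Ca Z1a).
exists (C `&` D), h'; split=> //; first exact: XI.
  by apply: Xr hD => //; apply: XI.
move=> b [B1b [Z1b Z2b]] [Cb Db].
by rewrite (gh b) //; apply: hh'.
Qed.

Section Lift.
Variables (W W' : vectType K) (T T' : Type).
Variables (P : set W) (p : W -> T) (Z : set T).
Variables (P' : set W') (p' : W' -> T') (Z' : set T').

Let X := sub_variety (quotient_variety (sub_variety (affine W) P) p) Z.
Let Y := sub_variety (quotient_variety (sub_variety (affine W') P') p') Z'.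

(* The lift has to descend to the quotients outside X as well: functions on X are
   regular when they extend locally to the ambient quotient. *)
Definition local_lift (f : T -> T') (s : W -> W') (d : W -> K) : Prop :=
  [/\ polymap s, polyfun d, forall w, P w -> d w != 0 -> P' (s w),
      forall w1 w2, P w1 -> P w2 -> p w1 = p w2 -> d w1 != 0 ->
        d w2 != 0 /\ p' (s w1) = p' (s w2) &
      forall w, P w -> pts X (p w) -> d w != 0 -> p' (s w) = f (p w)].

(** Compatibility of [s] with [p] makes the locus where [d] is nonzero and [p' (s w)] lies in B
    saturated; within P it is the preimage of an open set under a polynomial map. *)
Lemma local_lift_open f s d B :
  local_lift f s d ->
  zopen (quotient_variety (sub_variety (affine W') P') p') B ->
  zopen (quotient_variety (sub_variety (affine W) P) p)
    [set t | exists w, [/\ P w, p w = t, d w != 0 & B (p' (s w))]].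
Proof.
move=> [ps pd sP sp sf] [Bp [O oO OE]]; split=> [t [w [Pw <- _ _]] | ].
  by exists w.
exists [set w | d w != 0 /\ O (s w)].
  apply/affine_openP => a [da Oa].
  have [q pq [qa qO]] := (affine_openP O).1 oO _ Oa.
  exists (fun w => d w * q (s w)); first by apply: polyfunM => //; apply: polyfun_comp.
  rewrite mulf_neq0 //; split=> // b; rewrite mulf_eq0 negb_or => /andP[db qb].
  by split=> //; apply: qO.
have OB w : P w -> d w != 0 -> O (s w) <-> B (p' (s w)).
  move=> Pw dw; have P'w := sP w Pw dw.
  have -> : O (s w) = ((O `&` P') (s w)).
    by apply/propext; split=> [? | []].
  by rewrite -OE /=; split=> [[] | ].
apply/seteqP; split=> [w [[_ Pw] [w1 [Pw1 w1w d1 B1]]] | w [[dw Ow] Pw]].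
  have [dw sE] := sp _ _ Pw1 Pw w1w d1.
  by split=> //; split=> //; apply/OB => //; rewrite -sE.
by split=> //; exists w; split=> //; apply/OB.
Qed.

(** Open sets and functions are pulled back upstairs by polynomial substitution, and saturation lets
    the result descend. Each point may use its own lift. *)
Lemma regular_map_lift (f : T -> T') :
  (forall a, pts X a -> pts Y (f a)) ->
  (forall a, pts X a -> exists s d, local_lift f s d /\
     exists w, [/\ P w, p w = a & d w != 0]) ->
  regular_map X Y f.
Proof.
move=> fXY H; split=> // B [B0 oB0 BE].
split.
  (* One lift sees only part of the preimage, so the open set is the union over all of them. *)
  exists [set t | exists s d, local_lift f s d /\
      exists w, [/\ P w, p w = t, d w != 0 & B0 (p' (s w))]].
    split=> [t [s [d [L [w [Pw <- _ _]]]]] |]; first by exists w.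
    (* Openness is required in all of W, where points outside P are uncontrolled; so each point
       carries a basic neighbourhood on which the condition holds at the points of P. *)
    exists [set w | exists s d, local_lift f s d /\
      exists q, [/\ polyfun q, q w != 0 & forall w', q w' != 0 -> P w' ->
        d w' != 0 /\ B0 (p' (s w'))]].
      apply/affine_openP => a [s [d [L [q [pq qa qO]]]]].
      by exists q => //; split=> // b qb; exists s, d; split=> //; exists q.
    apply/seteqP; split=> [w [[_ Pw] [s [d [L E]]]] | w [[s [d [L [q [pq qw qO]]]]] Pw]].
      split=> //; exists s, d; split=> //.
      have [_ [O oO OE]] := local_lift_open L oB0.
      have Ow : (O `&` P) w by rewrite -OE.
      have [q pq [qw qO]] := (affine_openP O).1 oO w Ow.1.
      exists q; split=> // w' /qO Ow' Pw'.
      have : (O `&` P) w' by [].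
      rewrite -OE => -[_ [w1 [Pw1 w1w d1 B1]]].
      have [_ _ _ sp _] := L.
      by have [? <-] := sp _ _ Pw1 Pw' w1w d1.
    split=> //; exists s, d; split=> //; exists w.
    by have [] := qO w qw Pw.
  apply/seteqP; split=> [t [Xt] | t [[s [d [L [w [Pw wt dw Bw]]]]] Zt]].
    rewrite /preimage /= BE => -[Bt Z't]; split; last by case: Xt.
    have [s [d [L [w [Pw wt dw]]]]] := H t Xt.
    exists s, d; split=> //; exists w; split=> //.
    by have [_ _ _ _ ->] := L; rewrite ?wt.
  have Xt : pts X t by split=> //; exists w.
  split=> //; rewrite /preimage /= BE; split; last by case: (fXY _ Xt).
  by have [_ _ _ _ sf] := L; rewrite -wt -sf // wt.
move=> g gB /= a [Xa Ba].
have [B1 [g1 [oB1 B1a g1r gg1]]] : exists C h,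
  [/\ zopen (quotient_variety (sub_variety (affine W') P') p') C, C (f a),
     regfun (quotient_variety (sub_variety (affine W') P') p') C h &
    forall b, B b -> C b -> g b = h b] by apply: gB.
have [s [d [L [w0 [Pw0 w0a dw0]]]]] := H a Xa.
have oA := local_lift_open L oB1.
have [ps pd sP sp sf] := L.
(* A choice of representative of t. By compatibility [p' (s (r t))] does not depend on it, and the
   default [w0] is met only off the open set used below. *)
pose r t := xget w0 [set w | [/\ P w, p w = t & d w != 0]].
have rE w : P w -> d w != 0 -> p' (s (r (p w))) = p' (s w).
  move=> Pw dw; rewrite /r; case: xgetP => [w1 _ [Pw1 w1w dw1] | /(_ w)]; last first.
    by case.
  by have [] := sp _ _ Pw1 Pw w1w dw1.
exists [set t | exists w, [/\ P w, p w = t, d w != 0 & B1 (p' (s w))]],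
  (fun t => g1 (p' (s (r t)))); split=> //.
- by exists w0; split=> //; rewrite sf // w0a.
- move=> /= w [[_ Pw] [w1 [Pw1 w1w dw1 B1w1]]].
  have [dw spE] := sp _ _ Pw1 Pw w1w dw1.
  have B1w : B1 (p' (s w)) by rewrite -spE.
  have P'w : P' (s w) by apply: sP.
  have [B2 [g2 [oB2 B2w g2r g12]]] := g1r (s w) (conj (conj I P'w) B1w).
  have [e [h [q [pe ph pq ew ehq]]]] := (affine_regP B2 g2).1 g2r _ B2w.
  exists [set w | d w != 0 /\ e (s w) != 0], (fun w => h (s w) / q (s w)).
  split=> //.
  + apply/affine_openP => b [db eb]; exists (fun w => d w * e (s w)).
      by apply: polyfunM => //; apply: polyfun_comp.
    rewrite mulf_neq0 //; split=> // c; rewrite mulf_eq0 negb_or.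
    by move=> /andP[].
  + apply/affine_regP => b [db eb].
    exists (fun w => d w * e (s w)), (fun w => h (s w)), (fun w => q (s w)).
    split; rewrite ?mulf_neq0 //; [|exact: polyfun_comp|exact: polyfun_comp|].
      by apply: polyfunM => //; apply: polyfun_comp.
    move=> c; rewrite mulf_eq0 negb_or => /andP[dc ec].
    by have [] := ehq _ ec.
  + move=> b [[_ Pb] [b1 [Pb1 b1b db1 B1b1]]] [db eb] /=.
    rewrite rE //; have [B2b qb <-] := ehq _ eb.
    apply: g12 => //; split; first by split=> //; apply: sP.
    by rewrite /preimage /=; have [_ <-] := sp _ _ Pb1 Pb b1b db1.
- move=> t [Xt Bt] [w [Pw wt dw B1w]] /=.
  rewrite -wt rE // sf ?wt //; apply: gg1 => //.
  by rewrite -[t]wt -sf // wt.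
Qed.

End Lift.
End Topology.

(** * Frames and flags *)

Section Frames.
Variable K : fieldType.
Implicit Types V : vectType K.

(** The functionals are dual to the vectors only up to nonzero factors, because the frames below are
    not normalised. *)
Lemma free_dual V (I : eqType) (r : seq I) (g : I -> V) (t : I -> 'Hom(V, K^o)) :
  uniq r -> {in r &, forall i j, (t i (g j) != 0) = (i == j)} ->
  free (map g r).
Proof.
elim: r => [|i r IHr] /=; first by rewrite nil_free.
case/andP=> ir ur H; rewrite free_cons IHr ?andbT //; last first.
  by move=> j l jr lr; apply: H; rewrite inE ?jr ?lr orbT.
apply/negP => gi.
have /subvP /(_ _ gi) : (<<map g r>> <= lker (t i))%VS.
  apply/span_subvP => _ /mapP[j jr ->]; rewrite memv_ker.
  have := H i j; rewrite !inE eqxx jr orbT => /(_ isT isT).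
  by have /negPf -> : i != j by [apply: contraNneq ir => ->]; move/negbFE.
rewrite memv_ker => /eqP ti0; have := H i i; rewrite !inE eqxx ti0 eqxx.
by move=> /(_ isT isT).
Qed.

Lemma span_map_sub V (I : eqType) (r : seq I) (g : I -> V) (A : {vspace V}) :
  (forall i, i \in r -> g i \in A) -> (<<map g r>> <= A)%VS.
Proof. by move=> gA; apply/span_subvP => _ /mapP[i ir ->]; apply: gA. Qed.

Lemma dim_take_free V (X : seq V) i :
  free X -> (i <= size X)%N -> \dim <<take i X>> = i.
Proof.
rewrite -{1}(cat_take_drop i X) => /catl_free; rewrite /free => /eqP -> iX.
by rewrite size_take_min; apply/minn_idPl.
Qed.

Lemma span_take_sub V (X : seq V) i j :
  (i <= j)%N -> (<<take i X>> <= <<take j X>>)%VS.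
Proof.
by move=> ij; apply: sub_span => a; rewrite -(take_takel X ij) => /mem_take.
Qed.

Definition frame V (s : nat -> V) : {ffun 'I_(\dim {:V}) -> V} :=
  [ffun i : 'I__ => s i].

Lemma codom_frame V (s : nat -> V) : codom (frame s) = mkseq s (\dim {:V}).
Proof.
rewrite codomE /mkseq -val_enum_ord -map_comp; apply: eq_map => i.
by rewrite /= ffunE.
Qed.

Lemma frame_codom V (e : {ffun 'I_(\dim {:V}) -> V}) :
  e = frame (nth 0 (codom e)).
Proof.
apply/ffunP => i; rewrite ffunE codomE (nth_map i) ?nth_ord_enum //.
by rewrite size_enum_ord.
Qed.

Lemma take_mkseq (T : Type) (s : nat -> T) i m :
  (i <= m)%N -> take i (mkseq s m) = mkseq s i.
Proof. by move=> im; rewrite /mkseq -map_take take_iota (minn_idPl im). Qed.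

Lemma mem_mkseqP (T : eqType) (s : nat -> T) j a :
  reflect (exists2 i, (i < j)%N & a = s i) (a \in mkseq s j).
Proof.
apply: (iffP mapP) => -[i ij ->]; exists i => //; last by rewrite mem_iota.
by rewrite mem_iota in ij.
Qed.

Lemma fl_frame V (s : nat -> V) i : (i <= \dim {:V})%N ->
  fl (flag_of_frame (frame s)) i = <<mkseq s i>>%VS.
Proof.
by move=> iV; rewrite /fl /flag_of_frame nth_mkseq ?ltnS // codom_frame take_mkseq.
Qed.

Lemma mem_span_mkseq V (s : nat -> V) i j : (i < j)%N -> s i \in <<mkseq s j>>%VS.
Proof. by move=> ij; apply/memv_span/mem_mkseqP; exists i. Qed.

Lemma span_mkseqP V (s : nat -> V) j (A : {vspace V}) :
  (forall i, (i < j)%N -> s i \in A) -> (<<mkseq s j>> <= A)%VS.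
Proof.
by move=> sA; apply/span_subvP => _ /mem_mkseqP[i ij ->]; apply: sA.
Qed.

Lemma flag_ext V (F G : seq {vspace V}) : complete_flag F -> complete_flag G ->
  (forall i, (i <= \dim {:V})%N -> (fl F i <= fl G i)%VS) -> F = G.
Proof.
move=> [sF dF _] [sG dG _] FG; apply: (@eq_from_nth _ 0%VS); first by rewrite sF.
move=> i; rewrite sF ltnS => iV; apply/eqP.
by rewrite eqEdim FG //= dF // dG.
Qed.

Lemma frame_complete V (e : {ffun 'I_(\dim {:V}) -> V}) :
  free (codom e) -> complete_flag (flag_of_frame e).
Proof.
move=> fe; have se : size (codom e) = \dim {:V} by rewrite size_codom card_ord.
split=> [|i iV|i iV]; first by rewrite size_mkseq.
  by rewrite /fl nth_mkseq // dim_take_free // se.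
by rewrite /fl !nth_mkseq //; [apply: span_take_sub | apply: ltnW].
Qed.

Lemma complete_flag_sub V (F : seq {vspace V}) i j :
  complete_flag F -> (i <= j)%N -> (j <= \dim {:V})%N -> (fl F i <= fl F j)%VS.
Proof.
move=> [_ _ Fs] ij; elim: j ij => [|j IHj]; first by rewrite leqn0 => /eqP ->.
rewrite leq_eqVlt => /orP[/eqP -> // | ij jV].
by apply: subv_trans (IHj ij (ltnW jV)) (Fs _ jV).
Qed.

Lemma frame_scale V (s s' : nat -> V) (c : nat -> K) :
  (forall i, c i != 0) -> (forall i, s' i = c i *: s i) ->
  flag_of_frame (frame s') = flag_of_frame (frame s).
Proof.
move=> c0 sE; apply: (@eq_from_nth _ 0%VS); first by rewrite !size_mkseq.
move=> j; rewrite size_mkseq ltnS => jV; rewrite -!/(fl _ _) !fl_frame //.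
apply/eqP; rewrite eqEsubv; apply/andP; split; apply: span_mkseqP => i ij.
  by rewrite sE memvZ // mem_span_mkseq.
rewrite -[s i](scalerK (c0 i)) -sE memvZ // mem_span_mkseq //.
Qed.

End Frames.

(** * Symplectic frames and self-dual flags *)

Section Symplectic.
Variables (K : fieldType) (U : vectType K).
Notation V := (symp_space U).
Implicit Types a b c : V.

Definition lsymp a : 'Hom(V, K^o) := linfun (symp a : V -> K^o).

Lemma lsympE a b : lsymp a b = symp a b.
Proof. by rewrite linfunE //; apply: symp_linear. Qed.

Lemma sympDr a b c : symp a (b + c) = symp a b + symp a c.
Proof. by rewrite -!lsympE linearD. Qed.
Lemma sympZr k a b : symp a (k *: b) = k * symp a b.
Proof. by rewrite -!lsympE linearZ. Qed.
Lemma symp0r a : symp a 0 = 0.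
Proof. by rewrite -lsympE linear0. Qed.
Lemma sympDl a b c : symp (b + c) a = symp b a + symp c a.
Proof. by rewrite sympC sympDr opprD -!(sympC _ a). Qed.
Lemma sympZl k a b : symp (k *: b) a = k * symp b a.
Proof. by rewrite sympC sympZr -mulrN -sympC. Qed.
Lemma symp0l a : symp 0 a = 0.
Proof. by rewrite sympC symp0r oppr0. Qed.
Lemma sympNr a b : symp a (- b) = - symp a b.
Proof. by rewrite -scaleN1r sympZr mulN1r. Qed.
Lemma sympNl a b : symp (- b) a = - symp b a.
Proof. by rewrite -scaleN1r sympZl mulN1r. Qed.
Lemma symp_self a : symp a a = 0.
Proof. by rewrite /symp subrr. Qed.

Definition sympE := (sympDr, sympDl, sympZr, sympZl, symp0r, symp0l, sympNr, sympNl).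

Lemma symp_sumr (I : Type) (r : seq I) (P : pred I) (F : I -> V) a :
  symp a (\sum_(i <- r | P i) F i) = \sum_(i <- r | P i) symp a (F i).
Proof.
rewrite -lsympE linear_sum; apply: eq_bigr => i _; exact: lsympE.
Qed.

Lemma symp_nondeg a : (forall b, symp b a = 0) -> a = 0.
Proof.
case: a => u g H.
have g0 : g = 0.
  apply/lfunP => w; have := H (w, 0).
  by rewrite /symp /= !zero_lfunE subr0.
have u0 : u = 0.
  rewrite (coord_vbasis (memvf u)) big1 // => i _.
  have L : linear (coord (vbasis {:U}) i : U -> K^o) by move=> c a b; rewrite linearP.
  have := H (0, linfun (coord (vbasis {:U}) i : U -> K^o)).
  rewrite /symp /= linear0 linfunE // sub0r => /eqP; rewrite oppr_eq0 => /eqP ->.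
  by rewrite scale0r.
by rewrite g0 u0.
Qed.

Lemma perp_spanP (X : seq V) b :
  b \in perp <<X>> <-> (forall a, a \in X -> symp a b = 0).
Proof.
split=> [/perpP H a aX | H]; first by apply: H; apply: memv_span.
apply/perpP => a aX.
have : (<<X>> <= lker (lsymp b))%VS.
  apply/span_subvP => c cX; rewrite memv_ker lsympE sympC H //.
  by rewrite oppr0.
move=> /subvP /(_ _ aX); rewrite memv_ker lsympE => /eqP.
by rewrite sympC => /eqP; rewrite oppr_eq0 => /eqP.
Qed.

(** An antidiagonal Gram matrix with arbitrary nonzero entries: enough for F_j and F_{2n-j} to be
    mutually perpendicular, while frames can be written polynomially, without division. *)
Definition symplectic_frame (s : nat -> V) : Prop :=
  forall i j, (i < \dim {:V})%N -> (j < \dim {:V})%N ->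
    (symp (s i) (s j) != 0) = (i + j == (\dim {:V}).-1)%N.

Lemma symplectic_frame_free s : symplectic_frame s -> free (mkseq s (\dim {:V})).
Proof.
move=> H; apply: (@free_dual _ _ _ _ _ (fun i => lsymp (s ((\dim {:V}).-1 - i)%N))).
  exact: iota_uniq.
move=> i j; rewrite !mem_iota add0n => /andP[_ iV] /andP[_ jV].
rewrite lsympE H //; last by lia.
lia.
Qed.

(** The coordinate of a vector along [s i] with i >= dim - j is detected by the partner of [s i], of
    index dim - 1 - i < j, so it vanishes on the perpendicular space. *)
Lemma symplectic_frame_perp s j : symplectic_frame s -> (j <= \dim {:V})%N ->
  perp <<mkseq s j>> = <<mkseq s (\dim {:V} - j)>>%VS.
Proof.
move=> H jV; have fs := symplectic_frame_free H.
apply/eqP; rewrite eqEsubv; apply/andP; split; last first.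
  apply: span_mkseqP => i ij; apply/perp_spanP => _ /mem_mkseqP[l lj ->].
  apply/eqP; rewrite -[_ == 0]negbK H; lia.
apply/subvP => a /perp_spanP aj.
have bs : basis_of {:V} (mkseq s (\dim {:V})).
  by rewrite basisEfree fs subvf size_mkseq leqnn.
have bs' : basis_of {:V} (in_tuple (mkseq s (\dim {:V}))) by [].
rewrite (coord_basis bs' (memvf a)); apply: memv_suml => -[i /= i'] _.
have iV := i'; rewrite size_mkseq in iV; rewrite nth_mkseq //.
case: (ltnP i (\dim {:V} - j)) => ij; first by rewrite memvZ // mem_span_mkseq.
set cc := coord _ _ a.
have i1 : ((\dim {:V}).-1 - i < \dim {:V})%N by lia.
have : symp (s ((\dim {:V}).-1 - i)%N) a = 0.
  by apply: aj; apply/mem_mkseqP; exists ((\dim {:V}).-1 - i)%N => //; lia.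
rewrite {1}(coord_basis bs' (memvf a)) symp_sumr.
rewrite (bigD1 (Ordinal i')) //= big1 => [|[l /= l'] li].
  rewrite addr0 sympZr nth_mkseq // => /eqP; rewrite mulf_eq0 => /orP[|].
    by move=> /eqP; rewrite -/cc => ->; rewrite scale0r mem0v.
  by rewrite -[_ == 0]negbK H // => /negP[]; apply/eqP; lia.
have lV := l'; rewrite size_mkseq in lV; rewrite sympZr nth_mkseq //; apply/eqP; rewrite mulf_eq0.
apply/orP; right; rewrite -[_ == 0]negbK H //.
by apply: contra li => /eqP il; apply/eqP/val_inj => /=; lia.
Qed.

End Symplectic.

(** * A symplectic normal form *)

(* The symplectic basis E_j, f with dual basis es_j, fs, obtained from the one
   of eType by moving v_{21} into E_N = v; unlike in eType, v is then a single
   basis vector. *)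
Record normal_form (K : fieldType) (U : vectType K) (v : symp_space U)
    (x : 'End(symp_space U)) (N : nat) (E es : nat -> symp_space U)
    (f fs : symp_space U) : Prop := NormalForm {
  nf_E0 : E 0%N = 0;
  nf_EN : E N = v;
  nf_xE : forall j, (j < N)%N -> x (E j.+1) = E j;
  nf_xes : forall j, (0 < j)%N -> x (es j) = es j.+1;
  nf_es0 : forall j, (N < j)%N -> es j = 0;
  nf_xf : x f = 0;
  nf_xfs : x fs = 0;
  nf_Ees : forall j l, symp (E j) (es l) = ((j == l) && (0 < j <= N)%N)%:R;
  nf_EE : forall j l, symp (E j) (E l) = 0;
  nf_eses : forall j l, symp (es j) (es l) = 0;
  nf_Ef : forall j, symp (E j) f = 0;
  nf_Efs : forall j, symp (E j) fs = 0;
  nf_esf : forall j, symp (es j) f = 0;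
  nf_esfs : forall j, symp (es j) fs = 0;
  nf_ffs : symp f fs = 1;
  nf_expand : forall a, a = \sum_(j < N) (symp a (es j.+1) *: E j.+1 +
      symp (E j.+1) a *: es j.+1) + symp a fs *: f + symp f a *: fs }.

Lemma cells_hook N :
  cells (psum [:: N; 1%N] [::]) = [seq (1%N, j) | j <- iota 1 N] ++ [:: (2, 1)%N].
Proof. by rewrite /cells /psum /= /part /= !addn0. Qed.

Lemma cells_row N :
  cells (psum (nseq (0 < N) N) [::]) = [seq (1%N, j) | j <- iota 1 N].
Proof. by case: N => [|N] //; rewrite /cells /psum /= /part /= !addn0 cats0. Qed.

Lemma normal_form_exists (K : fieldType) (U : vectType K) (v : symp_space U)
    (x : 'End(symp_space U)) (N : nat) : (0 < N)%N ->
  eType (@symp _ U) v x ([:: N; 1%N], [::]) ->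
  \dim {:symp_space U} = N.+1.*2 /\
  exists E es f fs, normal_form v x N E es f fs.
Proof.
move=> N0 [_ [b [bs []]]]; rewrite /= cells_hook => bB bP vE xE.
have c1 j : (0 < j <= N)%N -> (1%N, j) \in [seq (1%N, j) | j <- iota 1 N] ++ [:: (2, 1)%N].
  by move=> jN; rewrite mem_cat map_f // mem_iota; lia.
have c2 : (2, 1)%N \in [seq (1%N, j) | j <- iota 1 N] ++ [:: (2, 1)%N].
  by rewrite mem_cat inE eqxx orbT.
have {vE} vE : v = b 1%N N + b 2%N 1%N.
  by rewrite vE big_nat_recl // big_nat1.
have xE1 j : (0 < j <= N)%N -> x (b 1%N j) = (if j == 1%N then 0 else b 1%N j.-1) /\
    x (bs 1%N j) = (if j == N then 0 else bs 1%N j.+1).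
  by move=> /c1 /xE; rewrite /= /part /= addn0.
have [xb2 xbs2] := xE _ c2; rewrite /= /part /= in xb2 xbs2.
have P11 j l : (0 < j <= N)%N -> (0 < l <= N)%N ->
   [/\ symp (b 1%N j) (bs 1%N l) = (j == l)%:R, symp (b 1%N j) (b 1%N l) = 0 &
      symp (bs 1%N j) (bs 1%N l) = 0].
  by move=> /c1 jN /c1 lN; have := bP _ _ jN lN; rewrite /= ?xpair_eqE /=.
have P12 j : (0 < j <= N)%N -> [/\ symp (b 1%N j) (bs 2%N 1%N) = 0,
     symp (b 1%N j) (b 2%N 1%N) = 0 & symp (bs 1%N j) (bs 2%N 1%N) = 0].
  by move=> /c1 jN; have := bP _ _ jN c2; rewrite /= ?xpair_eqE /=.
have P21 j : (0 < j <= N)%N -> [/\ symp (b 2%N 1%N) (bs 1%N j) = 0,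
     symp (b 2%N 1%N) (b 1%N j) = 0 & symp (bs 2%N 1%N) (bs 1%N j) = 0].
  by move=> /c1 jN; have := bP _ _ c2 jN; rewrite /= ?xpair_eqE /=.
have [P22 _ _] := bP _ _ c2 c2; have {}P22 : symp (b 2%N 1%N) (bs 2%N 1%N) = 1 by exact: P22.
(* Extending both chains by zero makes the relations with x uniform at their ends. *)
pose E j := if (0 < j <= N)%N then b 1%N j + (if j == N then b 2%N 1%N else 0) else 0.
pose es j := if (0 < j <= N)%N then bs 1%N j else 0.
(* Since E_N is [b 1 N + b 2 1], subtracting [bs 1 N] makes [fs] orthogonal to it; x still kills
   [fs], as the dual chain ends at N. *)
pose f := b 2%N 1%N; pose fs := bs 2%N 1%N - bs 1%N N.
have NN : (0 < N <= N)%N by rewrite N0 /=.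
have Ees j l : symp (E j) (es l) = ((j == l) && (0 < j <= N)%N)%:R.
  rewrite /E /es; case: ifP => jN; last by rewrite symp0l andbF.
  case lN : (0 < l <= N)%N.
    rewrite sympDl; have [-> _ _] := P11 _ _ jN lN; rewrite andbT.
    by case: ifP => _; rewrite ?symp0l; [have [-> _ _] := P21 _ lN|]; rewrite addr0.
  by rewrite symp0r andbT; case: eqP => // jl; rewrite jl lN in jN.
have EE j l : symp (E j) (E l) = 0.
  rewrite /E; case: ifP => jN; last by rewrite symp0l.
  case lN : (0 < l <= N)%N; last by rewrite symp0r.
  rewrite !sympE; have [_ -> _] := P11 _ _ jN lN; rewrite add0r.
  have [_ P _] := P21 _ lN; have [_ P' _] := P12 _ jN.
  by do 2!case: ifP => _; rewrite ?symp_self ?symp0l ?symp0r ?P ?P' ?addr0.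
have eses j l : symp (es j) (es l) = 0.
  rewrite /es; case: ifP => jN; last by rewrite symp0l.
  by case: ifP => lN; [have [_ _ ->] := P11 _ _ jN lN | rewrite symp0r].
have Ef j : symp (E j) f = 0.
  rewrite /E; case: ifP => jN; last by rewrite symp0l.
  rewrite sympDl; have [_ -> _] := P12 _ jN; rewrite add0r.
  by case: ifP; rewrite ?symp_self ?symp0l.
have Efs j : symp (E j) fs = 0.
  rewrite /E /fs; case: ifP => jN; last by rewrite symp0l.
  rewrite sympDr sympNr !sympDl.
  have [-> _ _] := P12 _ jN; have [-> _ _] := P11 _ _ jN NN.
  have [P _ _] := P21 _ NN.
  by case: (j == N); rewrite ?P22 ?P ?symp0l !(addr0, add0r) ?subrr ?oppr0.
have esf j : symp (es j) f = 0.
  rewrite /es; case: ifP => jN; last by rewrite symp0l.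
  by rewrite sympC; have [-> _ _] := P21 _ jN; rewrite oppr0.
have esfs j : symp (es j) fs = 0.
  rewrite /es /fs; case: ifP => jN; last by rewrite symp0l.
  by rewrite !sympE; have [_ _ ->] := P12 _ jN; have [_ _ ->] := P11 _ _ jN NN; rewrite subrr.
have ffs : symp f fs = 1.
  by rewrite /f /fs !sympE P22; have [-> _ _] := P21 _ NN; rewrite subr0.
split.
  rewrite -[RHS](_ : size ([seq b c.1 c.2 | c <- [seq (1%N, j) | j <- iota 1 N] ++
    [:: (2, 1)%N]] ++ [seq bs c.1 c.2 | c <- [seq (1%N, j) | j <- iota 1 N] ++
    [:: (2, 1)%N]]) = N.+1.*2).
    by rewrite -(span_basis bB); apply/eqP/(basis_free bB).
  by rewrite size_cat !size_map !size_cat !size_map size_iota /= addn1 addnn.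
exists E, es, f, fs; split=> //.
- by rewrite /E NN eqxx vE.
- move=> j jN; rewrite /E (_ : (0 < j.+1 <= N)%N) // linearD /=.
  have [-> _] := xE1 j.+1 jN.
  case: j jN => [|j] jN /=; rewrite ?add0r.
    by case: eqP => _; rewrite ?xb2 ?linear0.
  rewrite (ltnW jN) (_ : (j.+1 == N) = false) ?addr0; last by lia.
  by case: eqP => _; rewrite ?xb2 ?linear0 addr0.
- move=> j j0; rewrite /es j0 /=; case: ifP => jN; last first.
    by rewrite linear0 ifF //; lia.
  have [_ ->] := xE1 j (introT andP (conj j0 jN)); case: eqP => jN'; last by rewrite ifT //; lia.
  by rewrite ifF //; lia.
- by move=> j jN; rewrite /es ifF //; lia.
- by rewrite /fs linearB /= xbs2; have [_ ->] := xE1 N NN; rewrite eqxx subrr.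
have bE j : (0 < j <= N)%N -> b 1%N j = E j - (if j == N then f else 0).
  by move=> jN; rewrite /E jN addrK.
have bsE j : (0 < j <= N)%N -> bs 1%N j = es j by move=> jN; rewrite /es jN.
have b2E : b 2%N 1%N = f by [].
have bs2E : bs 2%N 1%N = fs + es N by rewrite /fs -bsE // subrK.
have E_out l : (0 < l <= N)%N = false -> E l = 0 by rewrite /E => ->.
have es_out l : (0 < l <= N)%N = false -> es l = 0 by rewrite /es => ->.
clearbody E es f fs.
(* The difference from the expansion is orthogonal to E, es, f and fs, hence to the original basis,
   hence zero by nondegeneracy. *)
move=> a; set a' := (X in _ = X); apply/eqP; rewrite -subr_eq0; apply/eqP.
have DE l : symp (E l) (a - a') = 0.
  rewrite !sympE symp_sumr Ef Efs !mulr0 !addr0.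
  case lN : (0 < l <= N)%N; last by rewrite E_out ?lN // symp0l sub0r big1 ?oppr0 //
    => i _; rewrite !sympE ?(mulr0, addr0).
  have l1 : (l.-1 < N)%N by lia.
  rewrite (bigD1 (Ordinal l1)) //= big1 ?addr0 => [|i il].
    by rewrite !sympE EE Ees (_ : l.-1.+1 = l) ?eqxx ?lN; [rewrite mulr0 mulr1 add0r subrr|lia].
  rewrite !sympE EE Ees mulr0 add0r; case: eqP => [li|]; last by rewrite mulr0.
  by case/eqP: il; apply: val_inj => /=; lia.
have Des l : symp (a - a') (es l) = 0.
  rewrite sympC !sympE symp_sumr esf esfs !mulr0 !addr0.
  case lN : (0 < l <= N)%N; last by rewrite es_out ?lN // symp0l sub0r big1 ?oppr0 //
    => i _; rewrite !sympE ?(mulr0, addr0).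
  have l1 : (l.-1 < N)%N by lia.
  rewrite (bigD1 (Ordinal l1)) //= big1 ?addr0 => [|i il].
    rewrite !sympE eses (sympC (es l) (E _)) Ees (_ : l.-1.+1 = l) ?eqxx ?lN; last by lia.
    by rewrite (sympC (es l) a) mulr0 addr0 mulrN1 subrr oppr0.
  rewrite !sympE eses (sympC (es l) (E _)) Ees mulr0 addr0; case: eqP => [li|];
    last by rewrite oppr0 mulr0.
  by case/eqP: il; apply: val_inj => /=; lia.
have Df : symp f (a - a') = 0.
  rewrite !sympE symp_sumr symp_self ffs mulr1 mulr0 addr0 big1 ?add0r ?subrr // => i _.
  by rewrite !sympE (sympC f (E _)) Ef (sympC f (es _)) esf oppr0 !mulr0 addr0.
have Dfs : symp (a - a') fs = 0.
  rewrite sympC !sympE symp_sumr symp_self (sympC fs f) ffs big1 ?add0r => [|i _].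
    by rewrite mulrN1 mulr0 addr0 (sympC fs a) subrr oppr0.
  by rewrite !sympE (sympC fs (E _)) Efs (sympC fs (es _)) esfs oppr0 !mulr0 addr0.
have Db j : (0 < j <= N)%N -> symp (b 1%N j) (a - a') = 0.
  by move=> jN; rewrite bE // sympDl DE sympNl; case: ifP; rewrite ?Df ?symp0l subr0.
have Dbs j : (0 < j <= N)%N -> symp (bs 1%N j) (a - a') = 0.
  by move=> jN; have := Des j; rewrite -bsE // sympC => /eqP; rewrite oppr_eq0 => /eqP.
have Dbs2 : symp (bs 2%N 1%N) (a - a') = 0.
  by rewrite bs2E -bsE // sympDl Dbs // addr0 sympC Dfs oppr0.
apply: symp_nondeg => c; have : c \in {:symp_space U}%VS by rewrite memvf.
rewrite -(span_basis bB) => cB; apply/eqP; rewrite sympC oppr_eq0.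
set s := (X in <<X>>%VS) in cB.
have sub : (<<s>> <= lker (lsymp (a - a')))%VS.
  have mem d : symp d (a - a') = 0 -> d \in lker (lsymp (a - a')).
    by move=> d0; rewrite memv_ker lsympE sympC d0 oppr0.
  rewrite /s span_cat subv_add; apply/andP; split; apply: span_map_sub => cc;
    rewrite mem_cat inE => /orP[/mapP[j jN ->] | /eqP ->]; apply: mem => /=.
  - by rewrite Db //; move: jN; rewrite mem_iota; lia.
  - by rewrite b2E Df.
  - by rewrite Dbs //; move: jN; rewrite mem_iota; lia.
  - exact: Dbs2.
by move: (subvP sub _ cB); rewrite memv_ker lsympE.
Qed.

(** * Exotic types of the quotients *)

(** [nseq (0 < k) k] is the one-part partition (k), empty for k = 0 because [shape_upto] drops empty
    rows. *)
Lemma shape_upto_tab n i k : (2 <= i <= n)%N -> (k <= n)%N ->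
  shape_upto k (tab n i).1 = if (i <= k)%N then [:: k.-1; 1%N] else nseq (0 < k) k.
Proof.
move=> iN kn; rewrite /shape_upto /tab /= addn0.
have -> : count (leq^~ k) [seq j <- iota 1 n | j != i] = (k - (i <= k))%N.
  rewrite count_filter -{1}(subnKC kn) iotaD count_cat.
  have -> : count (predI (leq^~ k) (fun j => j != i)) (iota (1 + k) (n - k)) = 0%N.
    apply/eqP; rewrite -leqn0 leqNgt -has_count; apply/hasPn => j.
    by rewrite mem_iota /= => jk; lia.
  rewrite addn0 (eq_in_count (a2 := predC (pred1 i))); last first.
    by move=> j; rewrite mem_iota /= => jk; rewrite (_ : (j <= k)%N) //; lia.
  have := count_predC (pred1 i) (iota 1 k); rewrite size_iota.
  rewrite (count_uniq_mem _ (iota_uniq 1 k)) mem_iota.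
  by set c := count _ _; case: leqP; lia.
case ik: (i <= k)%N => /=; last by rewrite subn0; case: (k).
by rewrite subn1 ifT //; lia.
Qed.

Section ExoticType.
Variables (K : fieldType) (E : vectType K) (w : E -> E -> K).
Variables (v : E) (x : E -> E).
Hypotheses (xD : forall a b, x (a + b) = x a + x b) (x0 : x 0 = 0).

Let iter0 r : iter r x 0 = 0.
Proof. by elim: r => //= r ->. Qed.

Let iterD r a b : iter r x (a + b) = iter r x a + iter r x b.
Proof. by elim: r => //= r ->; apply: xD. Qed.

Let iter_row (b : nat -> E) N r :
  (forall l, (0 < l <= N)%N -> x (b l) = if l == 1%N then 0 else b l.-1) ->
  (r < N)%N -> iter r x (b N) = b (N - r)%N.
Proof.
move=> xb; elim: r => [|r IHr] rN /=; first by rewrite subn0.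
rewrite IHr 1?ltnW // xb; last by lia.
by rewrite ifF; [congr b; lia | lia].
Qed.

(** Here v is the sum of the tops of two chains, of lengths N and 1. The map x is only assumed
    additive, since on a quotient it is a bare function. *)
Lemma eType_hook_iter N : (0 < N)%N ->
  eType w v x ([:: N; 1%N], [::]) -> iter N x v = 0.
Proof.
move=> N0 [_ [b [bs []]]]; rewrite /= cells_hook => _ _ -> xE.
rewrite big_nat_recl // big_nat1 /part /=.
have x2 : x (b 2%N 1%N) = 0 by have [] := xE (2, 1)%N; rewrite // mem_cat inE eqxx orbT.
have xb l : (0 < l <= N)%N -> x (b 1%N l) = if l == 1%N then 0 else b 1%N l.-1.
  move=> lN; have [] := xE (1%N, l) => //.
  by rewrite mem_cat map_f // mem_iota; lia.
rewrite iterD; case: N N0 {xE} xb => // N _ xb.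
rewrite [iter _ x (b 2%N 1%N)]iterSr x2 iter0 addr0 iterS (iter_row xb) // subSnn.
by rewrite xb.
Qed.

(** The iterate is the last nonzero vector of the chain below v. Together with [eType_hook_iter] for
    N = m - 1 this separates the two shapes of size m. *)
Lemma eType_row_iter m : (0 < m)%N ->
  eType w v x ([:: m], [::]) -> iter m.-1 x v != 0.
Proof.
move=> m0 [_ [b [bs []]]].
have -> : [:: m] = nseq (0 < m) m by rewrite m0.
rewrite [psum _ _]/(psum (nseq (0 < m) m) [::]) cells_row => bB bP -> xE.
have c l : (0 < l <= m)%N -> (1%N, l) \in [seq (1%N, j) | j <- iota 1 m].
  by move=> lm; rewrite map_f // mem_iota; lia.
rewrite m0 /= big_nat1 /part /=.
have xb l : (0 < l <= m)%N -> x (b 1%N l) = if l == 1%N then 0 else b 1%N l.-1.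
  by move=> /c /xE [].
rewrite (iter_row xb); last by lia.
apply: (free_not0 (basis_free bB)); rewrite mem_cat; apply/orP; left.
by apply/mapP; exists (1%N, (m - m.-1)%N) => //; apply: c; lia.
Qed.

End ExoticType.

(** * Exotic types of a quotient, read in the ambient space *)

Section Quotient.
Variables (K : fieldType) (U : vectType K).
Notation V := (symp_space U).
Variables (v : V) (x : 'End(V)) (L : {vspace V}).
Hypotheses (xS : in_S x) (Lperp : (L <= perp L)%VS) (xL : (x @: L <= L)%VS).

Let Q := quot (perp L) L.
Let cl := quot_class (perp L) L.
Let xQ : Q -> Q := fun a => cl (x (vsval a)).

Let clB a b : cl (a - b) = cl a - cl b.
Proof.
by rewrite addrC -scaleN1r /cl quot_class_linear scaleN1r addrC.
Qed.

Let clD a b : cl (a + b) = cl a + cl b.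
Proof. by rewrite -[a]scale1r /cl quot_class_linear !scale1r. Qed.

Let cl_eq0 a : a \in perp L -> (cl a == 0) = (a \in L).
Proof. exact: quot_class_eq0. Qed.

Let cl_rep a : a \in perp L -> vsval (cl a) - a \in L.
Proof.
move=> aL; rewrite -cl_eq0; last first.
  by rewrite memvB //; apply: (subvP (diffvSl _ L)); apply: subvsP.
by rewrite clB /cl vsval_quotK subrr.
Qed.

Let cl_rep_perp a : a \in perp L -> vsval (cl a) \in perp L.
Proof. by move=> aL; apply: (subvP (diffvSl _ L)); apply: subvsP. Qed.

Let symp_cl a b : a \in perp L -> b \in perp L ->
  symp (vsval (cl a)) (vsval (cl b)) = symp a b.
Proof.
move=> aL bL; have [/cl_rep ra /cl_rep rb] := (aL, bL).
rewrite -{1}(subrK a (vsval (cl a))) sympDl.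
rewrite (perpP L (vsval (cl b))).1 ?cl_rep_perp // add0r.
rewrite -{1}(subrK b (vsval (cl b))) sympDr sympC.
by rewrite (perpP L a).1 // oppr0 add0r.
Qed.

Let perp_x a : a \in perp L -> x a \in perp L.
Proof.
move=> /perpP aL; apply/perpP => b bL; rewrite -xS; apply: aL.
by apply: (subvP xL); apply: memv_img.
Qed.

Let cl_x a : a \in perp L -> xQ (cl a) = cl (x a).
Proof.
move=> aL; apply/eqP; rewrite -subr_eq0 -clB -linearB cl_eq0.
  by apply: (subvP xL); apply: memv_img; apply: cl_rep.
by apply: perp_x; rewrite memvB // cl_rep_perp.
Qed.

Let xQD a b : xQ (a + b) = xQ a + xQ b.
Proof.
have vD : vsval (a + b) = vsval a + vsval b by [].
by rewrite /xQ vD linearD clD.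
Qed.

Let xQ0 : xQ 0 = 0.
Proof. by apply: (addrI (xQ 0)); rewrite -xQD !addr0. Qed.

Let iter_cl r a : a \in perp L ->
  iter r xQ (cl a) = cl (iter r x a) /\ iter r x a \in perp L.
Proof.
move=> aL; elim: r => [|r [IH1 IH2]] //=.
by rewrite IH1 cl_x // perp_x.
Qed.

Let w (a b : Q) := symp (vsval a) (vsval b).

Lemma quot_hook_iter N : (0 < N)%N -> v \in perp L ->
  eType w (cl v) xQ ([:: N; 1%N], [::]) -> iter N x v \in L.
Proof.
move=> N0 vL /(eType_hook_iter xQD xQ0 N0).
by have [-> NL] := iter_cl N vL; move/eqP; rewrite cl_eq0.
Qed.

Lemma quot_row_iter m : (0 < m)%N -> v \in perp L ->
  eType w (cl v) xQ ([:: m], [::]) -> iter m.-1 x v \notin L.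
Proof.
move=> m0 vL /(eType_row_iter m0).
by have [-> mL] := iter_cl m.-1 vL; rewrite cl_eq0.
Qed.

(** The relations are needed only modulo L. Independence of the classes follows from the pairing,
    and spanning from the dimension of the quotient. *)
Lemma eType_quot m mn (la := psum mn.1 mn.2) (b bs : nat -> nat -> V) :
  \dim (perp L) = (\dim L + m.*2)%N -> is_bipartition m mn ->
  uniq (cells la) -> size (cells la) = m -> v \in perp L ->
  {in cells la, forall c, b c.1 c.2 \in perp L /\ bs c.1 c.2 \in perp L} ->
  {in cells la &, forall c d,
    [/\ symp (b c.1 c.2) (bs d.1 d.2) = (c == d)%:R,
        symp (b c.1 c.2) (b d.1 d.2) = 0 & symp (bs c.1 c.2) (bs d.1 d.2) = 0]} ->
  v - \sum_(1 <= i < (size mn.1).+1) b i (part mn.1 i) \in L ->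
  {in cells la, forall c,
    x (b c.1 c.2) - (if c.2 == 1%N then 0 else b c.1 c.2.-1) \in L /\
    x (bs c.1 c.2) - (if c.2 == part la c.1 then 0 else bs c.1 c.2.+1) \in L} ->
  eType w (cl v) xQ mn.
Proof.
move=> dL bip uc sc vL bL bP vE xE.
have dQ : \dim {:Q} = m.*2.
  rewrite dimvf /= -[LHS]/(\dim (perp L :\: L)).
  have := dimv_cap_compl (perp L) L.
  by rewrite (capv_idPr Lperp) dL => /addnI.
have cl0 : cl 0 = 0 by rewrite -(subrr 0) clB subrr.
have clE a c : a \in perp L -> a - c \in L -> cl a = cl c.
  move=> aL acL; apply/eqP; rewrite -subr_eq0 -clB cl_eq0 //.
  exact: (subvP Lperp).
have wP : {in cells la &, forall c d,
    [/\ w (cl (b c.1 c.2)) (cl (bs d.1 d.2)) = (c == d)%:R,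
        w (cl (b c.1 c.2)) (cl (b d.1 d.2)) = 0 &
        w (cl (bs c.1 c.2)) (cl (bs d.1 d.2)) = 0]}.
  move=> c d cla dla; have [bc bsc] := bL c cla; have [bd bsd] := bL d dla.
  by rewrite /w !symp_cl //; apply: bP.
split; first by rewrite dQ doubleK.
exists (fun i j => cl (b i j)), (fun i j => cl (bs i j)); split.
- rewrite basisEfree size_cat !size_map sc dQ addnn leqnn andbT subvf andbT.
  pose g (tc : bool * (nat * nat)) :=
    if tc.1 then cl (b tc.2.1 tc.2.2) else cl (bs tc.2.1 tc.2.2).
  (* The dual partner of [g tc]: pairing with it is, up to sign, the coordinate along [g tc]. *)
  pose h (tc : bool * (nat * nat)) :=
    if tc.1 then vsval (cl (bs tc.2.1 tc.2.2)) else vsval (cl (b tc.2.1 tc.2.2)).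
  pose hl tc : 'Hom(Q, K^o) := linfun (fun q : Q => symp (h tc) (vsval q) : K^o).
  have hlE tc q : hl tc q = symp (h tc) (vsval q).
    rewrite /hl linfunE // => k a a'.
    by rewrite linearP sympDr sympZr.
  pose r := [seq (true, c) | c <- cells la] ++ [seq (false, c) | c <- cells la].
  have -> : [seq cl (b c.1 c.2) | c <- cells la] ++
    [seq cl (bs c.1 c.2) | c <- cells la] = map g r by rewrite map_cat -!map_comp.
  apply: (@free_dual _ _ _ _ _ hl).
    rewrite cat_uniq !map_inj_uniq ?uc /= ?andbT; [|by move=> ? ? []..].
    by apply/hasPn => tc /mapP[c _ ->]; apply/mapP => -[].
  have neqC (a : K) : (- a != 0) = (a != 0) by rewrite oppr_eq0.
  move=> tc tc'; rewrite !mem_cat.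
  case/orP => /mapP[c cla ->]; case/orP => /mapP[d dla ->];
    rewrite hlE /h /g /= -/(w _ _) xpair_eqE /=.
  + have [wcd _ _] := wP _ _ dla cla.
    rewrite /w sympC -/(w _ _) wcd neqC [c == d]eq_sym.
    by case: (d == c); rewrite ?oner_eq0 ?eqxx.
  + by have [_ _ ->] := wP _ _ cla dla; rewrite eqxx.
  + by have [_ -> _] := wP _ _ cla dla; rewrite eqxx.
  + have [-> _ _] := wP _ _ cla dla.
    by case: (c == d); rewrite ?oner_eq0 ?eqxx.
- exact: wP.
- rewrite (clE _ _ vL vE).
  by elim/big_rec2: _ => [|i a c _ <-] //; rewrite clD.
- move=> c cla; have [bc bsc] := bL c cla; have [xb xbs] := xE c cla.
  rewrite !cl_x // (clE _ _ (perp_x bc) xb) (clE _ _ (perp_x bsc) xbs).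
  by split; case: eqP.
Qed.

End Quotient.

(** * The closure of C *)

(** The symplectic form of the plane <f, fs> in coordinates. *)
Definition det2 (K : fieldType) (a b : 'rV[K]_2) : K :=
  a 0 ord0 * b 0 ord_max - a 0 ord_max * b 0 ord0.

Lemma det2C (K : fieldType) (a b : 'rV[K]_2) : det2 a b = - det2 b a.
Proof. by rewrite /det2; ring. Qed.

Lemma det2Zl (K : fieldType) c (a b : 'rV[K]_2) : det2 (c *: a) b = c * det2 a b.
Proof. by rewrite /det2 !mxE; ring. Qed.

Lemma det2Zr (K : fieldType) c (a b : 'rV[K]_2) : det2 a (c *: b) = c * det2 a b.
Proof. by rewrite /det2 !mxE; ring. Qed.

Lemma det2_self (K : fieldType) (a : 'rV[K]_2) : det2 a a = 0.
Proof. by rewrite /det2; ring. Qed.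

Lemma det2_0l (K : fieldType) (a : 'rV[K]_2) : det2 0 a = 0.
Proof. by rewrite /det2 !mxE; ring. Qed.

Lemma det2_0r (K : fieldType) (a : 'rV[K]_2) : det2 a 0 = 0.
Proof. by rewrite /det2 !mxE; ring. Qed.

Lemma ord2P (j : 'I_2) : j = ord0 \/ j = ord_max.
Proof. by case: j => -[|[|]] // jlt; [left | right]; apply: val_inj. Qed.

Lemma det2_neq0 (K : fieldType) (a : 'rV[K]_2) : a != 0 -> exists b, det2 a b != 0.
Proof.
case: (eqVneq (a 0 ord0) 0) => a0; last first.
  exists (\row_j (if j == ord0 then 0 else 1)).
  by rewrite /det2 !mxE /= mulr0 subr0 mulr1.
case: (eqVneq (a 0 ord_max) 0) => a1; last first.
  exists (\row_j (if j == ord0 then 1 else 0)).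
  by rewrite /det2 !mxE /= mulr0 sub0r mulr1 oppr_eq0.
case/eqP; apply/rowP => j.
by case: (ord2P j) => ->; rewrite ?a0 ?a1 mxE.
Qed.

Lemma line_of_dim1 (K : fieldType) (W : vectType K) (A : {vspace W}) :
  \dim A = 1%N -> exists2 a, a != 0 & A = <[a]>%VS.
Proof.
move=> dA; exists (vpick A); first by rewrite vpick0 -dimv_eq0 dA.
apply/esym/eqP; rewrite eqEdim dA dim_vline vpick0 -dimv_eq0 dA andbT.
by rewrite -memvE memv_pick.
Qed.

Section Fibre.
Variables (K : fieldType) (U : vectType K).
Notation V := (symp_space U).
Variables (v : V) (x : 'End(V)) (N : nat) (E es : nat -> V) (f fs : V).
Hypothesis nf : normal_form v x N E es f fs.
Hypotheses (N0 : (0 < N)%N) (xS : in_S x) (dimU : \dim {:U} = N.+1).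
Hypothesis dimV : \dim {:V} = N.+1.*2.
Variable k : nat.
Hypothesis kN : (0 < k <= N)%N.
Notation W3 := (K^o * 'rV[K]_2)%type.

Let Ees := nf_Ees nf.
Let EE := nf_EE nf.
Let eses := nf_eses nf.
Let Ef := nf_Ef nf.
Let Efs := nf_Efs nf.
Let esf := nf_esf nf.
Let esfs := nf_esfs nf.
Let ffs := nf_ffs nf.

Let symp_opp (a b : V) c : symp a b = c -> symp b a = - c.
Proof. by rewrite sympC => <-; rewrite opprK. Qed.
Let symp_opp0 (a b : V) : symp a b = 0 -> symp b a = 0.
Proof. by move=> /symp_opp; rewrite oppr0. Qed.
Let fE j := symp_opp0 (Ef j).
Let fsE j := symp_opp0 (Efs j).
Let fes j := symp_opp0 (esf j).
Let fses j := symp_opp0 (esfs j).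
Let fsf := symp_opp ffs.
Let esE j l : symp (es j) (E l) = - ((l == j) && (0 < l <= N)%N)%:R.
Proof. exact: symp_opp. Qed.

Definition pf (u : 'rV[K]_2) : V := u 0 ord0 *: f + u 0 ord_max *: fs.
(** [pw] and [pws] identify K + K^2, the space containing the fibres of O + O(-1), with <E_k, f, fs>
    and with its dual partner <es_k, f, fs>; [wpair] is the form between these two copies. *)
Definition pw (w : W3) : V := w.1 *: E k + pf w.2.
Definition pws (w : W3) : V := w.1 *: es k + pf w.2.
Definition wpair (a b : W3) : K := a.1 * b.1 + det2 a.2 b.2.

Let base := (EE, eses, Ef, Efs, esf, esfs, fE, fsE, fes, fses, ffs, fsf).

Let E_pf l a : symp (E l) (pf a) = 0.
Proof. by rewrite /pf !sympE !base; ring. Qed.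
Let es_pf l a : symp (es l) (pf a) = 0.
Proof. by rewrite /pf !sympE !base; ring. Qed.
Let pf_es l a := symp_opp0 (es_pf l a).
Let pw_pw a b : symp (pw a) (pw b) = det2 a.2 b.2.
Proof. by rewrite /pw /pf !sympE !base !symp_self /det2; ring. Qed.
Let pws_pws a b : symp (pws a) (pws b) = det2 a.2 b.2.
Proof. by rewrite /pws /pf !sympE !base !symp_self /det2; ring. Qed.
Let pw_pws a b : symp (pw a) (pws b) = wpair a b.
Proof.
rewrite /pw /pws /pf !sympE !base !symp_self Ees eqxx kN /= mulr1n /wpair /det2.
by ring.
Qed.
Let E_pw l a : symp (E l) (pw a) = 0.
Proof. by rewrite /pw /pf !sympE !base; ring. Qed.
Let pw_E l a := symp_opp0 (E_pw l a).
Let es_pws l a : symp (es l) (pws a) = 0.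
Proof. by rewrite /pws /pf !sympE !base; ring. Qed.
Let pws_es l a := symp_opp0 (es_pws l a).
Let pw_es l a : l != k -> symp (pw a) (es l) = 0.
Proof.
move=> lk; rewrite /pw /pf !sympE !base Ees eq_sym (negPf lk) /= mulr0n.
by ring.
Qed.
Let pw_esk a : symp (pw a) (es k) = a.1.
Proof. by rewrite /pw /pf !sympE !base Ees eqxx kN /= mulr1n; ring. Qed.
Let pw_pf a b : symp (pw a) (pf b) = det2 a.2 b.
Proof. by rewrite /pw /pf !sympE !base !symp_self /det2; ring. Qed.
Let E_pws l a : l != k -> symp (E l) (pws a) = 0.
Proof.
by move=> lk; rewrite /pws /pf !sympE !base Ees (negPf lk) /= mulr0n; ring.
Qed.

(** Positions start at 0, so A at k-1 completes F_k and B at k completes F_{k+1}. The pair A, B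
    replaces the single vector g_k, whence the index shift below k and none above. *)
Definition lag_half (g : nat -> V) (A B : V) (i : nat) : V :=
  if (i.+1 < k)%N then g i.+1 else if i.+1 == k then A else
  if i == k then B else g i.

Lemma half_lt g A B i : (i.+1 < k)%N -> lag_half g A B i = g i.+1.
Proof. by rewrite /lag_half => ->. Qed.

Lemma half_gt g A B i : (k < i)%N -> lag_half g A B i = g i.
Proof.
move=> ki; rewrite /lag_half.
have -> : (i.+1 < k)%N = false by lia.
have -> : (i.+1 == k) = false by lia.
by have -> : (i == k) = false by lia.
Qed.

Lemma half_A g A B : lag_half g A B k.-1 = A.
Proof.
rewrite /lag_half prednK; last by lia.
by rewrite ltnn eqxx.
Qed.

Lemma half_B g A B : lag_half g A B k = B.
Proof.
rewrite /lag_half eqxx.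
have -> : (k.+1 < k)%N = false by lia.
by have -> : (k.+1 == k) = false by lia.
Qed.

(* The first half E_1 .. E_{k-1}, A, B, E_{k+1} .. E_N spans a Lagrangian, the
   second one is its dual basis in reverse order, up to scaling. *)
Definition sframe (A B A' B' : W3) (i : nat) : V :=
  if (i < N.+1)%N then lag_half E (pw A) (pw B) i
  else lag_half es (pws A') (pws B') (N.*2.+1 - i).

(** The pairings make A, B dual to A', B' up to factors; the two determinants make each half of the
    frame isotropic. *)
Definition dual_params (A B A' B' : W3) : Prop :=
  [/\ wpair A A' != 0, wpair B B' != 0, wpair A B' = 0 & wpair B A' = 0] /\
  det2 A.2 B.2 = 0 /\ det2 A'.2 B'.2 = 0.

Let half_E A B i j : det2 A.2 B.2 = 0 ->
  symp (lag_half E (pw A) (pw B) i) (lag_half E (pw A) (pw B) j) = 0.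
Proof.
move=> AB; have BA : det2 B.2 A.2 = 0 by rewrite det2C AB oppr0.
by rewrite /lag_half; do !case: ifP => _;
  rewrite ?EE ?E_pw ?pw_E ?pw_pw ?AB ?BA ?det2_self.
Qed.

Let half_es A B i j : det2 A.2 B.2 = 0 ->
  symp (lag_half es (pws A) (pws B) i) (lag_half es (pws A) (pws B) j) = 0.
Proof.
move=> AB; have BA : det2 B.2 A.2 = 0 by rewrite det2C AB oppr0.
by rewrite /lag_half; do !case: ifP => _;
  rewrite ?eses ?es_pws ?pws_es ?pws_pws ?AB ?BA ?det2_self.
Qed.

Let half_dual A B A' B' i j : dual_params A B A' B' ->
  (i <= N)%N -> (j <= N)%N ->
  (symp (lag_half E (pw A) (pw B) i) (lag_half es (pws A') (pws B') j) != 0) = (i == j).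
Proof.
move=> [[AA BB AB BA] _] iN jN.
have nat_neq0 (b c : bool) : b = c -> ((b : nat)%:R != 0 :> K) = c.
  by move=> ->; case: c; rewrite ?oner_eq0 ?eqxx.
rewrite /lag_half; case: (ltngtP i.+1 k) => ik.
- case: (ltngtP j.+1 k) => jk.
  + by rewrite Ees; apply: nat_neq0; lia.
  + case: (eqVneq j k) => jk'; first by rewrite E_pws ?eqxx; lia.
    by rewrite Ees; apply: nat_neq0; lia.
  + by rewrite E_pws ?eqxx; lia.
- case: (eqVneq i k) => ik'.
    case: (ltngtP j.+1 k) => jk.
    + by rewrite pw_es ?eqxx; lia.
    + case: (eqVneq j k) => jk'; first by rewrite pw_pws BB; lia.
      by rewrite pw_es ?eqxx; lia.
    + by rewrite pw_pws BA eqxx; lia.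
  case: (ltngtP j.+1 k) => jk.
  + by rewrite Ees; apply: nat_neq0; lia.
  + case: (eqVneq j k) => jk'; first by rewrite E_pws ?eqxx; lia.
    by rewrite Ees; apply: nat_neq0; lia.
  + by rewrite E_pws ?eqxx; lia.
- case: (ltngtP j.+1 k) => jk.
  + by rewrite pw_es ?eqxx; lia.
  + case: (eqVneq j k) => jk'; first by rewrite pw_pws AB eqxx; lia.
    by rewrite pw_es ?eqxx; lia.
  + by rewrite pw_pws AA; lia.
Qed.

Lemma sframe_symplectic A B A' B' : dual_params A B A' B' ->
  symplectic_frame (sframe A B A' B').
Proof.
move=> H; have [_ [AB AB']] := H => i j; rewrite dimV /sframe => iV jV.
case: (ltnP i N.+1) => iN; case: (ltnP j N.+1) => jN.
- by rewrite half_E // eqxx; lia.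
- by rewrite half_dual //; lia.
- by rewrite sympC oppr_eq0 half_dual //; lia.
- by rewrite half_es // eqxx; lia.
Qed.

Notation fib := (pts (springer_fibre v x)).

Lemma fib_complete F : fib F -> complete_flag F.
Proof. by move=> [_ []]. Qed.

Lemma fib_perp F i : fib F -> (i <= N.+1.*2)%N -> perp (fl F i) = fl F (N.+1.*2 - i)%N.
Proof. by move=> [_ []]; rewrite dimU => _ H _ _; apply: H. Qed.

Lemma fib_v F : fib F -> v \in fl F N.+1.
Proof. by move=> [_ []]; rewrite dimU. Qed.

Lemma fib_x F i a : fib F -> (i < N.+1.*2)%N -> a \in fl F i.+1 -> x a \in fl F i.
Proof.
move=> [_ []]; rewrite dimU => _ _ _ H iN aF.
by apply: (subvP (H i.+1 _)); [lia | apply: memv_img].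
Qed.

Lemma fib_sub F i j : fib F -> (i <= j <= N.+1.*2)%N -> (fl F i <= fl F j)%VS.
Proof.
move=> /fib_complete H /andP[ij jN]; apply: complete_flag_sub => //.
by rewrite dimV.
Qed.

Lemma fib_dim F i : fib F -> (i <= N.+1.*2)%N -> \dim (fl F i) = i.
Proof. by move=> /fib_complete [_ + _] iN; rewrite dimV => ->. Qed.

Lemma fib_isotropic F j : fib F -> (j <= N.+1)%N -> (fl F j <= perp (fl F j))%VS.
Proof. by move=> Ff jN; rewrite fib_perp //; [apply: fib_sub => // |]; lia. Qed.

Lemma fib_xsub F j : fib F -> (j <= N.+1.*2)%N -> (x @: fl F j <= fl F j)%VS.
Proof.
move=> Ff jN; apply/subvP => _ /memv_imgP[a aF ->]; case: j jN aF => [|j] jN aF.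
  have /eqP : \dim (fl F 0) = 0%N by rewrite fib_dim.
  by rewrite dimv_eq0 => /eqP F0; move: aF; rewrite F0 memv0 => /eqP ->; rewrite linear0 mem0v.
by apply: (subvP (fib_sub (i := j) Ff _)); [lia | apply: fib_x].
Qed.

(** E_N = v lies in F_{N+1}, and x lowers both indices by one. *)
Lemma fib_E F l j : fib F -> (l < j <= N.+1)%N -> E l \in fl F j.
Proof.
move=> Ff; have H i : (i <= N)%N -> E (N - i)%N \in fl F (N.+1 - i)%N.
  elim: i => [|i IHi] iN; first by rewrite !subn0 (nf_EN nf); apply: fib_v.
  rewrite -(nf_xE nf); last by lia.
  apply: fib_x => //; first by lia.
  have -> : (N.+1 - i.+1).+1 = (N.+1 - i)%N by lia.
  have -> : (N - i.+1).+1 = (N - i)%N by lia.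
  by apply: IHi; lia.
move=> lj; apply: (subvP (fib_sub (i := l.+1) Ff _)); first by lia.
have := H (N - l)%N.
have -> : (N - (N - l))%N = l by lia.
have -> : (N.+1 - (N - l))%N = l.+1 by lia.
by apply; lia.
Qed.

Lemma fib_E_perp F l a : fib F -> (l <= N)%N -> a \in fl F N.+1 -> symp (E l) a = 0.
Proof.
move=> Ff lN aF; have := subvP (fib_isotropic Ff (leqnn _)) _ aF.
by move/perpP; apply; apply: fib_E => //; lia.
Qed.

(* The closure of C, cut out of the Springer fibre by linear conditions: they say
   that F_{k-1} = <E_1 .. E_{k-1}> and F_{k+1} <= <E_1 .. E_k, f, fs>. *)
Definition Zset : set (seq {vspace V}) := [set F | [/\ fib F,
  forall a, a \in fl F (N.+1.*2 - k.-1)%N -> symp (E k.-1) a = 0 &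
  forall l a, (k < l)%N -> a \in fl F k.+1 -> symp a (es l) = 0]].

(** The first condition of [Zset] is membership of E_{k-1} in F_{k-1}, phrased through the
    perpendicular member so as to be the vanishing of a functional; x then lowers both indices. *)
Lemma Zset_E F j : Zset F -> (j < k)%N -> E j \in fl F j.
Proof.
move=> [Ff ZE _] jk.
have Ek : E k.-1 \in fl F k.-1.
  rewrite [X in fl F X](_ : k.-1 = (N.+1.*2 - (N.+1.*2 - k.-1))%N); last by lia.
  rewrite -fib_perp //; last by lia.
  apply/perpP => a aF; rewrite sympC; apply/eqP; rewrite oppr_eq0; apply/eqP; exact: ZE.
have H i : (i < k)%N -> E (k.-1 - i)%N \in fl F (k.-1 - i)%N.
  elim: i => [|i IHi] ik; first by rewrite subn0.
  rewrite -(nf_xE nf); last by lia.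
  apply: fib_x => //; first by lia.
  have -> : (k.-1 - i.+1).+1 = (k.-1 - i)%N by lia.
  by apply: IHi; lia.
by have := H (k.-1 - j)%N; rewrite (_ : k.-1 - (k.-1 - j) = j)%N; [apply; lia | lia].
Qed.

(** The coordinates along f and fs in [nf_expand]; [psi0] adds the one along E_k. *)
Definition phi0 (a : V) : 'rV[K]_2 :=
  \row_j (if j == ord0 then symp a fs else symp f a).
Definition psi0 (a : V) : W3 := (symp a (es k), phi0 a).

Let phi0_linear : linear phi0.
Proof.
move=> c a b; apply/rowP => j; rewrite !mxE.
by case: ifP; rewrite ?sympDl ?sympDr ?sympZl ?sympZr.
Qed.

Let psi0_linear : linear psi0.
Proof.
by move=> c a b; congr (_, _); rewrite ?phi0_linear //= sympDl sympZl.
Qed.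

Definition phi : 'Hom(V, 'rV[K]_2) := linfun phi0.
Definition psi : 'Hom(V, W3) := linfun psi0.

Lemma phiE a : phi a = phi0 a. Proof. by rewrite linfunE. Qed.
Lemma psiE a : psi a = (symp a (es k), phi a). Proof. by rewrite linfunE // phiE. Qed.

Lemma phi_pf u : phi (pf u) = u.
Proof.
rewrite phiE; apply/rowP => j; rewrite mxE /pf !sympE ffs !symp_self.
by case: (ord2P j) => -> /=; ring.
Qed.

Lemma phi_E l : phi (E l) = 0.
Proof.
rewrite phiE; apply/rowP => j; rewrite !mxE Efs fE.
by case: ifP.
Qed.

Lemma phi_pw w : phi (pw w) = w.2.
Proof. by rewrite linearD linearZ /= phi_E phi_pf scaler0 add0r. Qed.

Lemma psi_pw w : psi (pw w) = w.
Proof.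
by rewrite psiE phi_pw pw_esk; case: w.
Qed.

Lemma psi_E l : l != k -> psi (E l) = 0.
Proof. by move=> lk; rewrite psiE phi_E Ees (negPf lk). Qed.

Lemma pfZ c u : pf (c *: u) = c *: pf u.
Proof. by rewrite /pf !mxE scalerDr !scalerA. Qed.

Lemma pwZ c w : pw (c *: w) = c *: pw w.
Proof.
have e : c *: w = (c *: w.1, c *: w.2) by [].
by rewrite e /pw /= pfZ [RHS]scalerDr scalerA.
Qed.

Lemma pf_phi a : pf (phi a) = symp a fs *: f + symp f a *: fs.
Proof. by rewrite phiE /pf !mxE. Qed.

(** In [nf_expand] the hypotheses remove all es-components and the E-components beyond k; the
    components along E_k, f, fs make up [pw (psi a)], leaving only E_1 .. E_{k-1}. *)
Lemma decompose_mem (M : {vspace V}) a :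
  (forall l, (0 < l < k)%N -> E l \in M) ->
  (forall l, (l <= N)%N -> symp (E l) a = 0) ->
  (forall l, (k < l)%N -> symp a (es l) = 0) ->
  a - pw (psi a) \in M.
Proof.
move=> EM aE aes.
rewrite {1}(nf_expand nf a) -[_ + _ *: f + _]addrA -pf_phi psiE /pw opprD /=.
rewrite addrACA subrr addr0.
have k1 : (k.-1 < N)%N by lia.
rewrite (bigD1 (Ordinal k1)) //= (_ : k.-1.+1 = k); last by lia.
rewrite (aE k) ?scale0r ?addr0; last by lia.
rewrite addrAC subrr add0r; apply: memv_suml => -[i iN] /= ik.
rewrite aE // scale0r addr0.
have ik' : i.+1 != k.
  by apply: contra ik => /eqP ik; apply/eqP/val_inj => /=; lia.
case: (ltnP k i.+1) => ki; first by rewrite aes // scale0r mem0v.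
by rewrite memvZ // EM //; lia.
Qed.

Lemma pf_phi_mem (M : {vspace V}) a :
  (forall l, (0 < l <= k)%N -> E l \in M) ->
  (forall l, (l <= N)%N -> symp (E l) a = 0) ->
  (forall l, (k < l)%N -> symp a (es l) = 0) ->
  a - pf (phi a) \in M.
Proof.
move=> EM aE aes.
have -> : pf (phi a) = pw (psi a) - symp a (es k) *: E k.
  by rewrite psiE /pw /= addrC addKr.
rewrite opprB addrA addrAC; apply: memvD; last by rewrite memvZ // EM //; lia.
by apply: decompose_mem => // l lk; apply: EM; lia.
Qed.

Let dim_W j : (j <= N)%N -> \dim <<mkseq (fun i => E i.+1) j>> = j.
Proof.
move=> jN.
have : free (mkseq (fun i => E i.+1) j).
  apply: (@free_dual _ _ _ _ _ (fun i => lsymp (es i.+1))); first exact: iota_uniq.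
  move=> i l; rewrite !mem_iota lsympE esE oppr_eq0 eqSS => iN lN.
  rewrite (_ : (0 < l.+1 <= N)%N) ?andbT; last by lia.
  by rewrite [i == l]eq_sym; case: (l == i); rewrite ?oner_eq0 ?eqxx.
by rewrite /free size_mkseq => /eqP.
Qed.

Section InZ.
Variable F : seq {vspace V}.
Hypothesis ZF : Zset F.

Let Ff : fib F. Proof. by case: ZF. Qed.

Let Z_E a l : a \in fl F k.+1 -> (l <= N)%N -> symp (E l) a = 0.
Proof.
move=> aF lN; apply: (fib_E_perp Ff) => //.
by apply: (subvP (fib_sub Ff _)) aF; lia.
Qed.

Let Z_es a l : a \in fl F k.+1 -> (k < l)%N -> symp a (es l) = 0.
Proof. by case: ZF => _ _ H aF kl; apply: H. Qed.

Let Z_sub : (fl F k <= fl F k.+1)%VS.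
Proof. by apply: fib_sub => //; lia. Qed.

Lemma Zset_pf a : a \in fl F k.+1 -> pf (phi a) \in fl F k.+1.
Proof.
move=> aF; rewrite -(subKr a (pf _)) memvB // pf_phi_mem //.
- by move=> l lk; apply: fib_E => //; lia.
- by move=> l lN; apply: Z_E.
- by move=> l lk; apply: Z_es.
Qed.

Lemma Zset_pw a : a \in fl F k -> pw (psi a) \in fl F k.
Proof.
move=> aF; have aF' := subvP Z_sub _ aF; rewrite -(subKr a (pw _)) memvB // decompose_mem //.
- by move=> l lk; apply: fib_E => //; lia.
- by move=> l lN; apply: Z_E.
- by move=> l lk; apply: Z_es.
Qed.

(** The kernel of [phi] on F_{k+1} is <E_1 .. E_k>, of codimension one. [Zset_psi] is the same count
    one step lower. *)
Lemma Zset_phi : exists2 u, u != 0 & (phi @: fl F k.+1)%VS = <[u]>%VS.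
Proof.
apply: line_of_dim1.
have := limg_ker_dim phi (fl F k.+1); rewrite (fib_dim Ff); last by lia.
have -> : (fl F k.+1 :&: lker phi)%VS = <<mkseq (fun i => E i.+1) k>>%VS.
  apply/eqP; rewrite eqEsubv; apply/andP; split; last first.
    apply: span_mkseqP => i ik; rewrite memv_cap memv_ker phi_E eqxx andbT.
    by apply: fib_E => //; lia.
  apply/subvP => a; rewrite memv_cap memv_ker => /andP[aF /eqP a0].
  have -> : a = a - pf (phi a) by rewrite a0 /pf !mxE !scale0r addr0 subr0.
  apply: pf_phi_mem; [|by move=> l; apply: Z_E|by move=> l; apply: Z_es].
  move=> l lk; rewrite -(prednK (n := l)); last by lia.
  by apply: (mem_span_mkseq (fun i => E i.+1)); lia.
by rewrite dim_W; lia.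
Qed.

Lemma Zset_psi : exists2 w, w != 0 & (psi @: fl F k)%VS = <[w]>%VS.
Proof.
apply: line_of_dim1.
have := limg_ker_dim psi (fl F k); rewrite (fib_dim Ff); last by lia.
have -> : (fl F k :&: lker psi)%VS = <<mkseq (fun i => E i.+1) k.-1>>%VS.
  apply/eqP; rewrite eqEsubv; apply/andP; split; last first.
    apply: span_mkseqP => i ik; rewrite memv_cap memv_ker psi_E; last by lia.
    by rewrite eqxx andbT; apply: fib_E => //; lia.
  apply/subvP => a; rewrite memv_cap memv_ker => /andP[aF /eqP a0].
  have aF' := subvP Z_sub _ aF.
  have -> : a = a - pw (psi a) by rewrite a0 /pw /pf /= !mxE !scale0r !addr0 subr0.
  apply: decompose_mem; [|by move=> l; apply: Z_E|by move=> l; apply: Z_es].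
  move=> l lk; rewrite -(prednK (n := l)); last by lia.
  by apply: (mem_span_mkseq (fun i => E i.+1)); lia.
by rewrite dim_W; lia.
Qed.

Lemma Zset_incident (u : 'rV[K]_2) (w : W3) : (phi @: fl F k.+1)%VS = <[u]>%VS ->
  (psi @: fl F k)%VS = <[w]>%VS -> w.2 \in <[u]>%VS.
Proof.
move=> <- wE.
have /memv_imgP[a aF wa] : w \in (psi @: fl F k)%VS by rewrite wE memv_line.
by rewrite wa psiE /= memv_img //; apply: (subvP Z_sub).
Qed.

End InZ.

(* The line and the plane prescribed by the point ([u], [w]) at step k. *)
Definition fits (u : 'rV[K]_2) (w A B : W3) : Prop :=
  [/\ exists2 c, c != 0 & A = c *: w, E k \in (<[pw A]> + <[pw B]>)%VS,
      pf u \in (<[pw A]> + <[pw B]>)%VS, A.2 \in <[u]>%VS & B.2 \in <[u]>%VS].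

Let sframe_flag A B A' B' := flag_of_frame (frame (sframe A B A' B')).

(** The first N+1 frame vectors lie in the right members of F, so dimensions give equality up to the
    Lagrangian F_{N+1}; the upper members are perpendicular spaces of the lower ones. *)
Lemma sframe_unique F u w A B A' B' :
  Zset F -> (phi @: fl F k.+1)%VS = <[u]>%VS -> (psi @: fl F k)%VS = <[w]>%VS ->
  dual_params A B A' B' -> fits u w A B -> F = sframe_flag A B A' B'.
Proof.
move=> ZF uE wE dp [[c c0 Aw] _ _ _ Bu]; have [Ff _ _] := ZF.
have sf := sframe_symplectic dp.
set s := sframe _ _ _ _ in sf.
have cs : complete_flag (flag_of_frame (frame s)).
  by apply: frame_complete; rewrite codom_frame; apply: symplectic_frame_free.
have uF : pf u \in fl F k.+1.
  have /memv_imgP[a aF ->] : u \in (phi @: fl F k.+1)%VS by rewrite uE memv_line.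
  exact: Zset_pf.
have wF : pw w \in fl F k.
  have /memv_imgP[a aF ->] : w \in (psi @: fl F k)%VS by rewrite wE memv_line.
  exact: Zset_pw.
have EF : E k \in fl F k.+1 by apply: fib_E => //; lia.
have sF i : (i <= N)%N -> s i \in fl F i.+1.
  move=> iN; rewrite /s /sframe ltnS iN /lag_half.
  case: ifP => ik; first by apply: Zset_E.
  case: eqP => [->|ik'].
    by rewrite Aw pwZ memvZ.
  case: eqP => [->|ik'']; last by apply: fib_E => //; lia.
  have /vlineP[b bE] := Bu.
  by apply: memvD; [exact: memvZ | rewrite bE pfZ; exact: memvZ].
have sub i : (i <= N.+1)%N -> (<<mkseq s i>> <= fl F i)%VS.
  move=> iN; apply: span_mkseqP => j ji.
  by apply: (subvP (fib_sub (i := j.+1) Ff _)); [lia | apply: sF; lia].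
have eqF i : (i <= N.+1)%N -> <<mkseq s i>>%VS = fl F i.
  move=> iN; apply/eqP; rewrite eqEdim sub //= fib_dim //; last by lia.
  have [_ /(_ i)] := cs; rewrite fl_frame dimV; last by lia.
  by move=> ->; lia.
apply/esym/flag_ext => //; first exact: fib_complete.
move=> i; rewrite dimV => iV; rewrite fl_frame ?dimV //.
case: (leqP i N.+1) => iN; first exact: sub.
have -> : i = (N.+1.*2 - (N.+1.*2 - i))%N by lia.
rewrite -fib_perp //; last by lia.
by rewrite -eqF ?symplectic_frame_perp ?dimV //; lia.
Qed.

Lemma sframe_in_Zset u w A B A' B' :
  dual_params A B A' B' -> fits u w A B ->
  [/\ Zset (sframe_flag A B A' B'),
      (phi @: fl (sframe_flag A B A' B') k.+1)%VS = <[u]>%VS &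
      (psi @: fl (sframe_flag A B A' B') k)%VS = <[w]>%VS].
Proof.
move=> dp [[c c0 Aw] EAB uAB Au Bu].
have sf := sframe_symplectic dp.
rewrite /sframe_flag; set s := sframe _ _ _ _ in sf *; set F := flag_of_frame _.
have fF i : (i <= N.+1.*2)%N -> fl F i = <<mkseq s i>>%VS.
  by move=> iV; rewrite /F fl_frame // dimV.
have cs : complete_flag F.
  by apply: frame_complete; rewrite codom_frame; apply: symplectic_frame_free.
have sE i : (i <= N)%N -> s i = lag_half E (pw A) (pw B) i.
  by move=> iN; rewrite /s /sframe ltnS iN.
have sA : s k.-1 = pw A.
  by rewrite (sE k.-1); [exact: half_A | lia].
have sB : s k = pw B.
  by rewrite (sE k); [exact: half_B | lia].
have sAB (M : {vspace V}) : pw A \in M -> pw B \in M -> (<[pw A]> + <[pw B]> <= M)%VS.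
  by move=> AM BM; rewrite subv_add; apply/andP; split; [exact: AM | exact: BM].
have sABF i : (k < i)%N -> (<[pw A]> + <[pw B]> <= <<mkseq s i>>)%VS.
  by move=> ki; rewrite sAB // -?sA -?sB mem_span_mkseq //; lia.
(* The flag contains E_l already at step l for l < k, but only at step l+1 from k on, because of the
   inserted vector. *)
have EF l i : (l <= N)%N -> (if (l < k)%N then l <= i else l < i)%N -> E l \in <<mkseq s i>>%VS.
  move=> lN; case: ifP => lk li.
    case: l lN lk li => [|l] lN lk li; first by rewrite (nf_E0 nf) mem0v.
    have -> : E l.+1 = s l by rewrite sE ?half_lt //; lia.
    exact: mem_span_mkseq.
  case: (eqVneq l k) => [lk'|lk']; first by rewrite lk' (subvP (sABF _ _)) //; lia.
  have -> : E l = s l by rewrite sE ?half_gt //; lia.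
  exact: mem_span_mkseq.
have xpf u' : x (pf u') = 0.
  by rewrite linearD !linearZ /= (nf_xf nf) (nf_xfs nf) !scaler0 addr0.
have xpw w' : x (pw w') = w'.1 *: E k.-1.
  rewrite linearD linearZ /= xpf addr0 -[in E k](prednK (n := k)); last by lia.
  by rewrite (nf_xE nf) //; lia.
have perpF i : (i <= N.+1.*2)%N -> perp (fl F i) = fl F (N.+1.*2 - i)%N.
  by move=> iV; rewrite !fF ?symplectic_frame_perp ?dimV //; lia.
have xF1 i : (i <= N)%N -> (x @: fl F i.+1 <= fl F i)%VS.
  move=> iN; rewrite !fF; try lia.
  rewrite limg_span /mkseq -map_comp; apply: span_map_sub => j.
  rewrite mem_iota => /= ji; rewrite sE /lag_half; last by lia.
  case: ifP => jk; first by rewrite (nf_xE nf); [apply: EF; [|case: ifP] | ]; lia.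
  case: eqP => jk'; first by rewrite xpw memvZ // EF //; [|case: ifP]; lia.
  case: eqP => jk''; first by rewrite xpw memvZ // EF //; [|case: ifP]; lia.
  rewrite -(prednK (n := j)); last by lia.
  by rewrite (nf_xE nf); [apply: EF; [|case: ifP] | ]; lia.
have fibF : fib F.
  split.
    exists (frame s) => //; split=> //.
    by rewrite /= codom_frame; apply: symplectic_frame_free.
  split=> //.
  - by rewrite dimU => i iN; apply: perpF.
  - rewrite dimU fF; last by lia.
    by rewrite -(nf_EN nf); apply: EF => //; case: ifP; lia.
  - rewrite dimU => -[|i] // iV; rewrite [i.+1.-1]/=; case: (leqP i N) => iN; first exact: xF1.
    (* In the upper half, moving x across the form turns the inclusion into the one at the mirror
       step of the lower half. *)
    pose j := (N.+1.*2 - i.+1)%N; have jN : (j <= N)%N by rewrite /j; lia.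
    have e1 : i.+1 = (N.+1.*2 - j)%N by rewrite /j; lia.
    have e2 : i = (N.+1.*2 - j.+1)%N by lia.
    rewrite e1 e2 -(perpF j) -?(perpF j.+1); try by lia.
    apply/subvP => _ /memv_imgP[a /perpP aF ->]; apply/perpP => b bF.
    by rewrite -xS; apply: aF; apply: (subvP (xF1 j jN)); apply: memv_img.
split.
- split=> //.
    move=> a; rewrite -perpF; last by lia.
    by move/perpP; apply; rewrite fF; [apply: EF; [|case: ifP] | ]; lia.
  move=> l a kl; rewrite fF; last by lia.
  move=> aF; have : (<<mkseq s k.+1>> <= lker (lsymp (es l)))%VS.
    apply: span_mkseqP => i ik; rewrite memv_ker lsympE sE /lag_half; last by lia.
    rewrite sympC oppr_eq0; case: ifP => ik1.
      by rewrite Ees; have -> : (i.+1 == l) = false; [lia | rewrite eqxx].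
    have kl' : l != k by lia.
    case: ifP => ik2; first by rewrite pw_es // eqxx.
    by rewrite ifT ?pw_es ?eqxx //; lia.
  by move=> /subvP /(_ _ aF); rewrite memv_ker lsympE sympC oppr_eq0 => /eqP.
- apply/eqP; rewrite eqEsubv; apply/andP; split; last first.
    rewrite -memvE -(phi_pf u) memv_img // fF; last by lia.
    by apply: (subvP (sABF _ _)).
  rewrite fF; last by lia.
  rewrite limg_span /mkseq -map_comp; apply: span_map_sub => i.
  rewrite mem_iota => /= ik; rewrite sE /lag_half; last by lia.
  do 2?[case: ifP => ?; first by rewrite ?phi_E ?phi_pw ?mem0v].
  by case: ifP => ?; rewrite ?phi_E ?phi_pw ?mem0v.
- apply/eqP; rewrite eqEsubv; apply/andP; split; last first.
    have wA : w = c^-1 *: psi (pw A) by rewrite psi_pw Aw scalerK.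
    rewrite -memvE {1}wA memvZ // memv_img // fF -?sA; last by lia.
    by apply: mem_span_mkseq; lia.
  rewrite fF; last by lia.
  rewrite limg_span /mkseq -map_comp; apply: span_map_sub => i.
  rewrite mem_iota => /= ik; rewrite sE /lag_half; last by lia.
  case: ifP => ik1; first by rewrite psi_E ?mem0v //; lia.
  by rewrite ifT ?psi_pw ?Aw ?memvZ ?memv_line //; lia.
Qed.

(** * Two charts of symplectic frames *)

Lemma chart1_dual (w : W3) d : det2 w.2 d != 0 ->
  dual_params w (1, 0) (0, d) (- det2 w.2 d, w.1 *: d).
Proof.
(* The chart of flags with E_k outside F_k: B stands for E_k, the auxiliary d only has to pair with
   w, and B' is chosen so that its two contributions to the pairing with w cancel. *)
move=> wd; rewrite /dual_params /wpair /= !det2Zr det2_0l det2_self.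
split; last by rewrite det2_0r mulr0.
by split; rewrite ?mulr0 ?mul0r ?mul1r ?add0r ?addr0 ?oppr_eq0 //; ring.
Qed.

Lemma chart1_fits (u : 'rV[K]_2) (w : W3) d : det2 w.2 d != 0 -> w.2 \in <[u]>%VS ->
  fits u w w (1, 0).
Proof.
move=> wd wu.
have pwB : pw (1, 0) = E k by rewrite /pw /pf /= !mxE !scale0r !addr0 scale1r.
have EM : E k \in (<[pw w]> + <[pw (1%R, 0%R)]>)%VS.
  by rewrite pwB (subvP (addvSr _ _)) // memv_line.
split=> //=; [by exists 1; rewrite ?oner_eq0 ?scale1r | | exact: mem0v].
have /vlineP[t tE] := wu.
have t0 : t != 0 by apply: contraNneq wd => t0; rewrite tE t0 scale0r det2_0l.
have -> : pf u = t^-1 *: (pw w - w.1 *: E k).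
  by rewrite /pw addrC addKr tE pfZ scalerA mulVf // scale1r.
by rewrite memvZ // memvB ?memvZ // (subvP (addvSl _ _)) // memv_line.
Qed.

(** The chart around flags with E_k in F_k. On the surface [w.2] is a multiple of u and A is
    [det2 u d] times w; writing its second component as a multiple of u keeps A and B orthogonal for
    arbitrary u and w, off the surface included. *)
Lemma chart2_dual (u : 'rV[K]_2) (w : W3) d : w.1 * det2 u d != 0 ->
  dual_params (det2 u d * w.1, det2 w.2 d *: u) (0, u) (1, 0)
    (- det2 w.2 d, w.1 *: d).
Proof.
move=> wd; rewrite /dual_params /wpair /= !det2Zr !det2Zl !det2_0r !det2_0l det2_self.
split; last by split; exact: mulr0.
split; rewrite ?mulr0 ?mul0r ?mulr1 ?addr0 ?add0r //; first by rewrite mulrC.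
by ring.
Qed.

Lemma chart2_fits (u : 'rV[K]_2) (w : W3) d : w.1 * det2 u d != 0 -> w.2 \in <[u]>%VS ->
  fits u w (det2 u d * w.1, det2 w.2 d *: u) (0, u).
Proof.
rewrite mulf_eq0 negb_or => /andP[w0 ud] wu.
have /vlineP[t tE] := wu.
have pwB : pw (0, u) = pf u by rewrite /pw scale0r add0r.
set A := (X in fits _ _ X _).
have uM : pf u \in (<[pw A]> + <[pw (0%R, u)]>)%VS.
  by rewrite pwB (subvP (addvSr _ _)) // memv_line.
split=> //=.
- exists (det2 u d) => //; rewrite /A tE.
  have -> : det2 u d *: w = (det2 u d *: w.1, det2 u d *: w.2) by [].
  by rewrite tE; congr (_, _); rewrite det2Zl scalerA mulrC.
- have -> : E k = (det2 u d * w.1)^-1 *: (pw A - det2 w.2 d *: pf u).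
    by rewrite /pw /A /= pfZ addrK scalerA mulVf ?scale1r // mulf_neq0.
  by rewrite memvZ // memvB ?memvZ // (subvP (addvSl _ _)) // memv_line.
- by rewrite memvZ ?memv_line.
- exact: memv_line.
Qed.

(** * Exotic types along the flags of C *)

Let iter_E r : (r <= N)%N -> iter r x v = E (N - r)%N.
Proof.
elim: r => [|r IHr] rN /=; first by rewrite subn0 (nf_EN nf).
rewrite IHr 1?ltnW // (_ : N - r = (N - r.+1).+1)%N; last by lia.
by rewrite (nf_xE nf) //; lia.
Qed.

Let C := C_var v x (N.+2 - k).

(** Step j sees the entries up to N + 1 - j, and the second-row entry N + 2 - k is among them
    exactly when j < k. *)
Lemma C_Phi F j : C F -> (j <= N.+1)%N ->
  Phi v x F j (if (j < k)%N then [:: N - j; 1]%N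
    else nseq (0 < N.+1 - j) (N.+1 - j)%N, [::]).
Proof.
move=> [_]; rewrite dimU => H jN; have mN : (N.+1 - j <= N.+1)%N by lia.
have := H _ mN; rewrite subKn //; set T := tab _ _.
have -> : shape_upto (N.+1 - j) T.2 = [::] by [].
rewrite shape_upto_tab; [|lia|lia].
have -> : (N.+2 - k <= N.+1 - j)%N = (j < k)%N by lia.
by have -> : (N.+1 - j).-1 = (N - j)%N by lia.
Qed.

(** The hook at step k-1 and the row at step k give E_{k-1} in F_{k-1} and E_k outside F_k. Thus
    F_{k-1} = <E_1 .. E_{k-1}> and F_{k+1} = F_k + <E_k>. *)
Lemma C_sub_Zset F : C F -> Zset F.
Proof.
move=> CF; have Ff : fib F by case: CF.
have vP j : (j <= N.+1)%N -> v \in perp (fl F j).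
  move=> jN; rewrite fib_perp //; last by lia.
  by apply: (subvP (fib_sub (i := N.+1) Ff _)); [lia | exact: fib_v].
have Ek1 : E k.-1 \in fl F k.-1.
  have := @C_Phi F k.-1 CF ltac:(lia); rewrite ifT; last by lia.
  move=> /(@quot_hook_iter _ _ _ _ _ xS (@fib_xsub F k.-1 Ff ltac:(lia))
    (N - k.-1) ltac:(lia) (vP k.-1 ltac:(lia))).
  rewrite iter_E; last by lia.
  by rewrite (_ : N - (N - k.-1) = k.-1)%N //; lia.
have Ek : E k \notin fl F k.
  have := @C_Phi F k CF ltac:(lia); rewrite ltnn (_ : (0 < N.+1 - k)%N); last by lia.
  move=> /(@quot_row_iter _ _ _ _ _ xS (@fib_xsub F k Ff ltac:(lia))
    (N.+1 - k) ltac:(lia) (vP k ltac:(lia))).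
  rewrite iter_E; last by lia.
  by rewrite (_ : N - (N.+1 - k).-1 = k)%N //; lia.
have EW i : (i < k)%N -> E (k.-1 - i)%N \in fl F k.-1.
  elim: i => [|i IHi] ik; first by rewrite subn0.
  rewrite -(nf_xE nf); last by lia.
  rewrite (_ : (k.-1 - i.+1).+1 = k.-1 - i)%N; last by lia.
  by apply: (subvP (fib_xsub Ff _)); [lia | apply: memv_img; apply: IHi; lia].
have FW : fl F k.-1 = <<mkseq (fun i => E i.+1) k.-1>>%VS.
  apply/esym/eqP; rewrite eqEdim dim_W ?fib_dim ?leqnn ?andbT; try lia; try done.
  apply: span_mkseqP => i ik; rewrite (_ : i.+1 = (k.-1 - (k.-1 - i.+1)))%N; last by lia.
  by apply: EW; lia.
(* Write es_l as x es_{l-1} and move x across the form: it sends F_k into <E_1 .. E_{k-1}>, which is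
   orthogonal to es_{l-1}. *)
have Fk_es b l : b \in fl F k -> (k < l)%N -> symp b (es l) = 0.
  move=> bF kl; have -> : es l = x (es l.-1).
    by rewrite (nf_xes nf); [congr es | ]; lia.
  rewrite -xS; have : x b \in fl F k.-1.
    apply: fib_x => //; first by lia.
    by rewrite prednK //; lia.
  rewrite FW => xb; have : (<<mkseq (fun i => E i.+1) k.-1>> <= lker (lsymp (es l.-1)))%VS.
    apply: span_mkseqP => i ik; rewrite memv_ker lsympE esE.
    by have -> : (i.+1 == l.-1) = false; [lia | rewrite oppr0 eqxx].
  by move=> /subvP /(_ _ xb); rewrite memv_ker lsympE sympC oppr_eq0 => /eqP.
split=> //.
  move=> a; rewrite -fib_perp //; last by lia.
  by move/perpP; apply.
move=> l a kl.
have -> : fl F k.+1 = (fl F k + <[E k]>)%VS.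
  apply/esym/eqP; rewrite eqEdim subv_add fib_sub -?memvE ?fib_E //; try lia.
  rewrite fib_dim //; last by lia.
  have := dimv_sum_cap (fl F k) <[E k]>; rewrite fib_dim //; last by lia.
  have Ek0 : E k != 0 by apply: contraNneq Ek => ->; apply: mem0v.
  have -> : (fl F k :&: <[E k]>)%VS = 0%VS.
    apply/eqP; rewrite -subv0; apply/subvP => b; rewrite memv_cap memv0.
    case/andP => bF /vlineP[c cE]; move: bF; rewrite cE; case: (eqVneq c 0) => [->|c0].
      by rewrite scale0r.
    by move=> /(memvZ c^-1); rewrite scalerK // (negPf Ek).
  by rewrite dimv0 addn0 dim_vline Ek0 addn1 => ->; rewrite leqnn.
case/memv_addP => b bF [_ /vlineP[c ->] ->].
by rewrite sympDl Fk_es // sympZl Ees (_ : (k == l) = false) ?mulr0 ?addr0 //; lia.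
Qed.

Lemma Phi_hook F j : fib F -> (j < k)%N -> fl F j = <<mkseq (fun i => E i.+1) j>>%VS ->
  Phi v x F j ([:: N - j; 1]%N, [::]).
Proof.
move=> Ff jk FE; set L := fl F j in FE.
have EL l : (l <= N)%N -> E l \in perp L.
  by move=> lN; rewrite FE; apply/perp_spanP => _ /mem_mkseqP[i ij ->].
have esL l : (j < l)%N -> es l \in perp L.
  move=> jl; rewrite FE; apply/perp_spanP => _ /mem_mkseqP[i ij ->].
  by rewrite Ees (_ : (_ == _) = false) //; lia.
have fL : f \in perp L by rewrite FE; apply/perp_spanP => _ /mem_mkseqP[i ij ->].
have fsL : fs \in perp L by rewrite FE; apply/perp_spanP => _ /mem_mkseqP[i ij ->].
have EjL : E j \in L.
  rewrite FE; case: (posnP j) => [->|j0]; first by rewrite (nf_E0 nf) mem0v.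
  rewrite -(prednK j0); apply: (mem_span_mkseq (fun i => E i.+1)); lia.
have m0 : (0 < N - j)%N by lia.
(* This undoes the change of basis behind the normal form, with the chains shifted by j. *)
pose b i l := if i == 1%N then E (l + j)%N - (if l == (N - j)%N then f else 0) else f.
pose bs i l := if i == 1%N then es (l + j)%N else fs + es N.
have inc : {in cells (psum [:: N - j; 1]%N [::]), forall c,
    (exists2 l, c = (1, l)%N & (0 < l <= N - j)%N) \/ c = (2, 1)%N}.
  move=> c; rewrite cells_hook mem_cat inE => /orP[/mapP[l lN ->] | /eqP ->].
    by left; exists l => //; move: lN; rewrite mem_iota; lia.
  by right.
apply: (@eType_quot _ _ v x L xS _ _ (N.+1 - j) _ b bs).
- by apply: fib_isotropic => //; lia.
- by apply: fib_xsub => //; lia.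
- by rewrite fib_perp ?fib_dim //; lia.
- rewrite /is_bipartition /is_partition /= !inE.
  by rewrite (_ : (0 == N - j)%N = false) /=; lia.
- rewrite cells_hook cat_uniq map_inj_uniq ?iota_uniq /=; last by move=> ? ? [].
  by rewrite orbF andbT; apply/mapP => -[].
- by rewrite cells_hook size_cat size_map size_iota /=; lia.
- by rewrite -(nf_EN nf); apply: EL.
- move=> c /inc [[l -> lN]|->]; rewrite /b /bs /=.
    by split; [apply: memvB; [apply: EL; lia | case: ifP => _; rewrite ?mem0v] | apply: esL; lia].
  by split=> //; apply: memvD => //; apply: esL; lia.
- move=> c d /inc [[l -> lN]|->] /inc [[m -> mN]|->]; rewrite /b /bs /= ?xpair_eqE /=.
  + have EfE (t t' : bool) p q : symp (E p - (if t then f else 0))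
        (E q - (if t' then f else 0)) = 0.
      by case: t; case: t'; rewrite !sympE !base ?symp_self; ring.
    split=> //; rewrite !sympE Ees eqn_add2r (_ : (0 < l + j <= N)%N) ?andbT; last by lia.
    by case: ifP => _; rewrite ?fes ?symp0l subr0.
  + split; last by rewrite sympDr esfs eses addr0.
      rewrite !sympE !base Ees; case: eqP => lN'.
        have -> : (l + j == N)%N by lia.
        have -> : (0 < l + j <= N)%N by lia.
        by rewrite ffs fes /= mulr1n; ring.
      have -> : (l + j == N)%N = false by lia.
      by rewrite !symp0l /= mulr0n; ring.
    by rewrite !sympE Ef; case: ifP => _; rewrite ?symp_self ?symp0l; ring.
  + split; first exact: fes.
      by rewrite !sympE fE; case: ifP => _; rewrite ?symp_self ?symp0r; ring.
    by rewrite sympDl fses eses addr0.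
  + by rewrite !sympE ffs fes !base !symp_self !addr0.
- rewrite big_nat_recl // big_nat1 /part /b /= eqxx subrK subnK; last by lia.
  by rewrite (nf_EN nf) subrr mem0v.
- move=> c /inc [[l -> lN]|->]; rewrite /b /bs /part /=.
    rewrite addn0; split; last first.
      rewrite (nf_xes nf) ?addn_gt0; last by lia.
      case: eqP => lN'; last by rewrite addSn subrr mem0v.
      by rewrite (nf_es0 nf) ?subr0 ?mem0v //; lia.
    rewrite linearB /= -[l in E (l + j)%N](prednK (n := l)); last by lia.
    rewrite addSn (nf_xE nf); last by lia.
    have -> : x (if l == (N - j)%N then f else 0) = 0.
      by case: ifP => _; rewrite ?linear0 // (nf_xf nf).
    case: eqP => [->|l1]; first by rewrite add0n !subr0.
    by rewrite (_ : (l.-1 == _) = false) ?subr0 ?subrr ?mem0v //; lia.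
  rewrite linearD /= (nf_xf nf) (nf_xfs nf) (nf_xes nf) // (nf_es0 nf) //.
  by rewrite !addr0 !subr0 mem0v.
Qed.

(** As E_{j-1} lies in F_j, the classes of E_j .. E_N form one chain. Since es_j need not be
    orthogonal to F_j, it is corrected by [pf d], which x kills and which is orthogonal to all E_l
    and es_l. *)
Lemma Phi_row F j d : fib F -> (0 < j <= N.+1)%N ->
  es j + pf d \in perp (fl F j) ->
  (forall l, (j < l)%N -> es l \in perp (fl F j)) ->
  Phi v x F j (nseq (0 < N.+1 - j) (N.+1 - j)%N, [::]).
Proof.
move=> Ff jN dL esL; set m := (N.+1 - j)%N; set L := fl F j in dL esL *.
have EL l : (l <= N)%N -> E l \in perp L.
  move=> lN; rewrite fib_perp //; last by lia.
  by apply: (subvP (fib_sub (i := N.+1) Ff _)); [lia | apply: fib_E => //; lia].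
have EjL l : (l < j)%N -> E l \in L by move=> lj; apply: fib_E => //; lia.
pose b (i l : nat) := E (l + j).-1.
pose bs (i l : nat) := es (l + j).-1 + (if l == 1%N then pf d else 0).
have inc : {in cells (psum (nseq (0 < m) m) [::]), forall c,
    exists2 l, c = (1, l)%N & (0 < l <= m)%N}.
  move=> c; rewrite cells_row => /mapP[l lN ->].
  by exists l => //; move: lN; rewrite mem_iota; lia.
apply: (@eType_quot _ _ v x L xS _ _ m _ b bs).
- by apply: fib_isotropic => //; lia.
- by apply: fib_xsub => //; lia.
- by rewrite fib_perp ?fib_dim //; lia.
- rewrite /is_bipartition /is_partition /=; case: (m) => [|p] //=.
  by rewrite !addn0 eqxx.
- by rewrite cells_row map_inj_uniq ?iota_uniq //; move=> ? ? [].
- by rewrite cells_row size_map size_iota.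
- by rewrite -(nf_EN nf); apply: EL.
- move=> c /inc [l -> lN]; rewrite /b /bs /=; split; first by apply: EL; lia.
  case: eqP => [->|l1]; first by rewrite add1n.
  by rewrite addr0; apply: esL; lia.
- move=> c c' /inc [l -> lN] /inc [p -> pN]; rewrite /b /bs /= xpair_eqE /=.
  have epf (t t' : bool) q r : symp (es q + (if t then pf d else 0))
      (es r + (if t' then pf d else 0)) = 0.
    by rewrite !sympDl !sympDr; case: t; case: t';
      rewrite ?symp0l ?symp0r ?eses ?es_pf ?pf_es ?symp_self ?addr0.
  split=> //.
  rewrite sympDr Ees (_ : (0 < (l + j).-1 <= N)%N) ?andbT; last by lia.
  rewrite (_ : ((l + j).-1 == (p + j).-1) = (l == p)); last by lia.
  by case: ifP => _; rewrite ?E_pf ?symp0r addr0.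
- case m0 : (0 < m)%N => /=; last first.
    rewrite big_geq // subr0.
    by have := fib_v Ff; rewrite /L (_ : N.+1 = j) //; lia.
  rewrite big_nat1 /part /b /= (_ : (m + j).-1 = N); last by lia.
  by rewrite (nf_EN nf) subrr mem0v.
- move=> c /inc [l -> lN]; rewrite /b /bs /=.
  have -> : part (psum (nseq (0 < m) m) [::]) 1 = m.
    by rewrite (_ : (0 < m)%N) /psum /part /= ?addn0 //; lia.
  have xpf u' : x (pf u') = 0.
    by rewrite linearD !linearZ /= (nf_xf nf) (nf_xfs nf) !scaler0 addr0.
  split.
    rewrite -[in x _](prednK (n := (l + j).-1)); last by lia.
    rewrite (nf_xE nf); last by lia.
    case: eqP => [->|l1]; first by rewrite add1n subr0 /= EjL //; lia.
    by rewrite (_ : (l + j).-1.-1 = (l.-1 + j).-1) ?subrr ?mem0v //; lia.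
  rewrite linearD /= (nf_xes nf); last by lia.
  have -> : x (if l == 1%N then pf d else 0) = 0.
    by case: ifP; rewrite ?xpf ?linear0.
  rewrite addr0; case: eqP => lm; first by rewrite (nf_es0 nf) ?subr0 ?mem0v //; lia.
  rewrite (_ : (l.+1 == 1%N) = false) ?addr0; last by lia.
  by rewrite (_ : (l + j).-1.+1 = (l.+1 + j).-1) ?subrr ?mem0v //; lia.
Qed.

Lemma chart1_in_C (w : W3) d : det2 w.2 d != 0 ->
  C (sframe_flag w (1, 0) (0, d) (- det2 w.2 d, w.1 *: d)).
Proof.
move=> wd; have dp := chart1_dual wd.
have [[Ff _ _] _ _] := sframe_in_Zset dp (chart1_fits wd (memv_line _)).
pose s := sframe w (1, 0) (0, d) (- det2 w.2 d, w.1 *: d).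
set F := sframe_flag _ _ _ _ in Ff *.
have fF i : (i <= N.+1.*2)%N -> fl F i = <<mkseq s i>>%VS.
  by move=> iV; rewrite /F /sframe_flag fl_frame // dimV.
have sE i : (i <= N)%N -> s i = lag_half E (pw w) (pw (1, 0)) i.
  by move=> iN; rewrite /s /sframe ltnS iN.
have pwB : pw (1, 0) = E k by rewrite /pw /pf /= !mxE !scale0r !addr0 scale1r.
split=> //; rewrite dimU => m mN.
have -> : shape_upto m (tab N.+1 (N.+2 - k)).2 = [::] by [].
rewrite shape_upto_tab; [|lia|lia].
case: ifP => km.
  rewrite (_ : m.-1 = N - (N.+1 - m))%N; last by lia.
  apply: Phi_hook => //; first by lia.
  rewrite fF; last by lia.
  congr <<_>>%VS; apply/eq_in_map => i; rewrite mem_iota => iN.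
  by rewrite sE /lag_half; [rewrite ifT // | ]; lia.
rewrite -{2 3}(subKn mN).
(* Only at step k is a correction needed: there es_k pairs with [pw w] to [w.1], and d' solves w.1 +
   det2 w.2 d' = 0. *)
pose d' := if (N.+1 - m == k)%N then - (w.1 / det2 w.2 d) *: d else 0.
have jk : (k <= N.+1 - m)%N by lia.
apply: (@Phi_row _ _ d') => //; first by lia.
  rewrite fF; last by lia.
  apply/perp_spanP => _ /mem_mkseqP[i iN ->].
  have E0 l : (l < N.+1 - m)%N -> symp (E l) (es (N.+1 - m)%N + pf d') = 0.
    by move=> lj; rewrite sympDr E_pf addr0 Ees (_ : (_ == _) = false) //; lia.
  rewrite sE /lag_half; last by lia.
  case: ifP => ik; first by apply: E0; lia.
  case: eqP => ik'; last by rewrite pwB; case: eqP => ik''; apply: E0; lia.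
  rewrite sympDr /d'; case: eqP => [->|jk'].
    by rewrite pw_esk pw_pf det2Zr; field.
  by rewrite pw_es ?add0r; [rewrite /pf !mxE !scale0r addr0 symp0r | apply/eqP].
move=> l jl; rewrite fF; last by lia.
apply/perp_spanP => _ /mem_mkseqP[i iN ->]; rewrite sE /lag_half; last by lia.
case: ifP => ik; first by rewrite Ees (_ : (_ == _) = false) //; lia.
case: eqP => ik'; first by rewrite pw_es //; lia.
by rewrite pwB; case: eqP => ik''; rewrite Ees (_ : (_ == _) = false) //; lia.
Qed.

End Fibre.

Lemma functional_neq0 (K : fieldType) (V : vectType K) (a : V) :
  a != 0 -> exists l : 'Hom(V, K^o), l a != 0.
Proof.
move=> a0; have cL j : linear (coord (vbasis {:V}) j : V -> K^o).
  by move=> c b d; rewrite linearP.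
have [/existsP[j aj] | /existsPn H] :=
    boolP [exists j, coord (vbasis {:V}) j a != 0].
  by exists (linfun (coord (vbasis {:V}) j : V -> K^o)); rewrite linfunE.
case/eqP: a0; rewrite (coord_vbasis (memvf a)) big1 // => j _.
by have := H j; rewrite negbK => /eqP ->; rewrite scale0r.
Qed.

Lemma line_eq (K : fieldType) (V : vectType K) (a b : V) :
  a \in <[b]>%VS -> a != 0 -> <[a]>%VS = <[b]>%VS.
Proof.
move=> ab a0; apply/eqP; rewrite eqEdim -memvE ab !dim_vline a0 /=.
by case: (b != 0).
Qed.

Lemma line_scaleE (K : fieldType) (V : vectType K) (a : V) c :
  c != 0 -> <[c *: a]>%VS = <[a]>%VS.
Proof.
move=> c0; case: (eqVneq a 0) => [-> | a0]; first by rewrite scaler0.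
by apply: line_eq; [rewrite memvZ ?memv_line | rewrite scaler_eq0 negb_or c0].
Qed.

Lemma line_scale (K : fieldType) (V : vectType K) (a b : V) :
  a != 0 -> <[a]>%VS = <[b]>%VS -> exists2 c, c != 0 & b = c *: a.
Proof.
move=> a0 ab; have /vlineP[c bE] : b \in <[a]>%VS by rewrite ab memv_line.
exists c => //; apply: contraNneq a0 => c0.
by rewrite -memv0 -(span_seq1 0) span_seq1 -(scale0r a) -c0 -bE -ab memv_line.
Qed.

(** * The isomorphism *)

Section Minors.
Variables (K : fieldType) (V : vectType K) (t : nat -> 'Hom(V, K^o)).

Definition minor_mx m (chi : 'Hom(V, K^o)) (e : nat -> V) : 'M[K]_m.+1 :=
  \matrix_(i, j) (if (i < m)%N then t i (e j) else chi (e j)).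

(* The combination of e_0, .., e_m killed by t_0, .., t_{m-1} given by Cramer's
   rule: up to a scalar it depends only on the span of e_0, .., e_m. *)
Definition minor_vec m (e : nat -> V) : V :=
  \sum_(j < m.+1) cofactor (minor_mx m 0 e) ord_max j *: e j.

(** Laplace expansion along the last row, whose cofactors do not see chi; hence the harmless 0 in
    [minor_vec]. *)
Lemma minor_vec_det m (chi : 'Hom(V, K^o)) e : chi (minor_vec m e) = \det (minor_mx m chi e).
Proof.
rewrite (expand_det_row _ ord_max) linear_sum; apply: eq_bigr => j _.
rewrite linearZ /= mxE ltnn mulrC /GRing.scale /=; congr (_ * _).
rewrite /cofactor; congr (_ * \det _).
apply/matrixP => a b; rewrite !mxE.
have -> : (lift ord_max a < m)%N by rewrite lift_max.
by [].
Qed.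

Lemma minor_vec_span m e : minor_vec m e \in <<mkseq e m.+1>>%VS.
Proof.
by apply: memv_suml => j _; rewrite memvZ //; apply: mem_span_mkseq.
Qed.

Let mkseqT m (e : nat -> V) := [tuple e i | i < m].

Let mkseqTE m e : mkseqT m e = mkseq e m :> seq V.
Proof.
by rewrite /= /mkseq -val_enum_ord -map_comp.
Qed.

Let nth_mkseqT m e (i : 'I_m) : (mkseqT m e)`_i = e i.
Proof. by rewrite mkseqTE nth_mkseq. Qed.

(** A change of basis multiplies each [minor_mx] by its matrix B; after testing against all
    functionals, the vector is multiplied by det B. *)
Lemma minor_vec_flag m e e' : free (mkseq e m) -> free (mkseq e' m) ->
  (0 < m)%N -> <<mkseq e m>>%VS = <<mkseq e' m>>%VS ->
  exists2 c, c != 0 & minor_vec m.-1 e' = c *: minor_vec m.-1 e.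
Proof.
case: m => // m fe fe' _ ee' /=.
pose B : 'M[K]_m.+1 := \matrix_(i, j) coord (mkseqT m.+1 e) i (e' j).
have BE (j : 'I_m.+1) : e' j = \sum_i B i j *: e i.
  have : e' j \in <<mkseqT m.+1 e>>%VS by rewrite mkseqTE ee' mem_span_mkseq.
  move/coord_span => {1}->; apply: eq_bigr => i _.
  by rewrite mxE nth_mkseqT.
clearbody B.
have dB : \det B != 0.
  apply/negP; rewrite -det_tr => /det0P[c c0 cB]; case/negP: c0; apply/eqP.
  apply/rowP => j; rewrite mxE.
  have fe'T : free (mkseqT m.+1 e') by rewrite mkseqTE.
  move/freeP: fe'T => /(_ (fun j => c 0 j)); apply.
  transitivity (\sum_(l < m.+1) \sum_i (c 0 l * B i l) *: e i).
    apply: eq_bigr => l _; rewrite nth_mkseqT {1}BE scaler_sumr.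
    by apply: eq_bigr => i _; rewrite scalerA.
  rewrite exchange_big big1 //= => i _; rewrite -scaler_suml.
  have -> : \sum_l c 0 l * B i l = (c *m B^T) 0 i.
    by rewrite mxE; apply: eq_bigr => l _; rewrite [B^T _ _]mxE.
  by rewrite cB mxE scale0r.
exists (\det B) => //; apply/eqP; rewrite -subr_eq0; apply/negP => /negP /functional_neq0.
case=> l; rewrite linearB linearZ /= !minor_vec_det.
have -> : minor_mx m l e' = minor_mx m l e *m B.
  apply/matrixP => i j; rewrite !mxE; under eq_bigr do rewrite !mxE.
  rewrite BE; case: ifP => im; rewrite linear_sum; apply: eq_bigr => p _;
    by rewrite linearZ /= mulrC.
by rewrite det_mulmx mulrC subrr eqxx.
Qed.

Lemma minor_mx_det_neq0 m (chi : 'Hom(V, K^o)) e : free (mkseq e m.+1) ->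
  (forall a, a \in <<mkseq e m.+1>>%VS -> (forall i, (i < m)%N -> t i a = 0) ->
     chi a = 0 -> a = 0) ->
  \det (minor_mx m chi e) != 0.
Proof.
move=> fe H; rewrite -det_tr; apply/negP => /det0P[c c0 cM].
case/negP: c0; apply/eqP/rowP => j; rewrite mxE.
have feT : free (mkseqT m.+1 e) by rewrite mkseqTE.
move/freeP: feT => /(_ (fun j => c 0 j)); apply.
under eq_bigr do rewrite nth_mkseqT.
have E (i : 'I_m.+1) : (if (i < m)%N then t i else chi) (\sum_(l < m.+1) c 0 l *: e l) = 0.
  have /rowP/(_ i) := cM; rewrite !mxE => <-; rewrite linear_sum.
  apply: eq_bigr => l _; rewrite linearZ /= !mxE.
  by case: ifP.
apply: H => [|i im|].
- by apply: memv_suml => l _; rewrite memvZ // mem_span_mkseq.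
- have im' : (i < m.+1)%N by apply: ltnW.
  by have := E (Ordinal im'); rewrite /= im.
- by have := E ord_max; rewrite /= ltnn.
Qed.

Lemma polymap_minor_vec (W : vectType K) m (e : nat -> W -> V) :
  (forall j, polymap (e j)) -> polymap (fun w => minor_vec m (fun j => e j w)).
Proof.
move=> pe; apply: polymap_sum => j; apply: polymapZ (pe j).
apply: polyfunM; first exact: polyfun_cst.
apply: polyfun_det => a b.
apply: (@polyfun_ext _ _ (fun w =>
  if (lift (ord_max : 'I_m.+1) a < m)%N then t (lift (ord_max : 'I_m.+1) a) (e (lift j b) w)
  else 0)).
  by move=> w; rewrite !mxE zero_lfunE.
case: (lift (ord_max : 'I_m.+1) a < m)%N; [exact: pe | exact: polyfun_cst].
Qed.

End Minors.

Lemma polymap_nth_codom (K : fieldType) (V : vectType K) m j :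
  polymap (fun e : {ffun 'I_m -> V} => nth 0 (codom e) j).
Proof.
case: (ltnP j m) => jm; last first.
  move=> l; apply: polyfun_ext (polyfun_cst _ 0) => e.
  by rewrite nth_default ?size_codom ?card_ord ?linear0.
have L : linear (fun e : {ffun 'I_m -> V} => e (Ordinal jm)).
  by move=> c a b; rewrite !ffunE.
move=> l; apply: polyfun_ext (polymap_linear
  (linfun (fun e : {ffun 'I_m -> V} => e (Ordinal jm))) (@polymap_id _ _) l) => e.
rewrite linfunE //; congr (l _).
by rewrite codomE (nth_map (Ordinal jm)) ?size_enum_ord // (nth_ord_enum _ (Ordinal jm)).
Qed.

(** The flags whose j-th member is not killed by l form an open set: on frames, l is nonzero on one
    of the first j vectors. *)
Lemma closure_linear (K : fieldType) (V : vectType K) (Z C : set (seq {vspace V}))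
    (l : 'Hom(V, K^o)) j F : (j <= \dim {:V})%N ->
  zclosure (sub_variety (flag_variety V) Z) C F ->
  (forall G a, C G -> a \in fl G j -> l a = 0) ->
  forall a, a \in fl F j -> l a = 0.
Proof.
move=> jV [[FV FZ] Fcl] HC a aF; apply/eqP; apply/negP => /negP la.
pose B := [set G | pts (flag_variety V) G /\ exists2 b, b \in fl G j & l b != 0].
have oB : zopen (flag_variety V) B.
  split=> [G [] //|].
  exists [set e : {ffun 'I_(\dim {:V}) -> V} |
     exists2 i, (i < j)%N & l (nth 0 (codom e) i) != 0].
    apply/affine_openP => e [i ij li].
    exists (fun e : {ffun 'I_(\dim {:V}) -> V} => l (nth 0 (codom e) i)).
      by apply: polymap_nth_codom.
    by split=> // e' li'; exists i.
  have flE (e : {ffun 'I_(\dim {:V}) -> V}) :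
      fl (flag_of_frame e) j = <<mkseq (nth 0%R (codom e)) j>>%VS.
    by rewrite {1}(frame_codom e) fl_frame.
  apply/seteqP; split=> [e [[_ fe] [_ [b]]] | e [[i ij li] fe]].
    rewrite flE => bs lb; split=> //.
    apply: contrapT => H; case/negP: lb.
    have : (<<mkseq (nth 0%R (codom e)) j>> <= lker l)%VS.
      apply: span_mkseqP => i ij; rewrite memv_ker; apply/negP => /negP li.
      by apply: H; exists i.
    by move=> /subvP /(_ _ bs); rewrite memv_ker.
  split=> //; split; first by exists e.
  exists (nth 0 (codom e) i) => //.
  by rewrite flE mem_span_mkseq.
have [G [[_ [b bG lb]] _] CG] : exists2 G, (B `&` Z) G & C G.
  by apply: Fcl; [exists B | split=> //; split=> //; exists a].
by case/negP: lb; rewrite (HC _ _ CG bG).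
Qed.

Lemma power_vec1 (K : fieldType) (u : 'rV[K]_2) : power_vec 1 u = u.
Proof.
apply/rowP => j; rewrite mxE; case: (ord2P j) => -> /=.
  by rewrite expr1 expr0 mulr1.
by rewrite expr1 expr0 mul1r.
Qed.

Lemma bundle_fibreP (K : fieldType) (u : 'rV[K]_2) (w : (K^o * 'rV[K]_2)%type) :
  (<[w]> <= bundle_fibre 1 u)%VS = (w.2 \in <[u]>%VS).
Proof.
rewrite -memvE /bundle_fibre power_vec1; apply/memv_addP/vlineP.
  case=> a /vlineP[c ->] [b /vlineP[d ->] ->]; exists d.
  by rewrite /= scaler0 add0r.
case=> d wE; exists (w.1 *: (1, 0)); first by rewrite memvZ ?memv_line.
exists (d *: (0, u)); first by rewrite memvZ ?memv_line.
case: w wE => w1 w2 /= ->; congr (_, _) => /=.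
  by rewrite scaler0 addr0 /GRing.scale /= mulr1.
by rewrite scaler0 add0r.
Qed.

Lemma SigmaP (K : fieldType) l : pts (Sigma_neg K 1) l <->
  exists (u : 'rV[K]_2) (w : (K^o * 'rV[K]_2)%type),
    [/\ u != 0, w != 0, w.2 \in <[u]>%VS & l = (<[u]>%VS, <[w]>%VS)].
Proof.
split=> [[[[u w] [_ [/= u0 w0]] <-] [u' u'0 /= [uu' wu]]] | [u [w [u0 w0 wu ->]]]].
  exists u, w; split=> //; rewrite uu'.
  by rewrite -bundle_fibreP.
split; first by exists (u, w).
exists u => //; split=> //=; by rewrite bundle_fibreP.
Qed.

(** * The bijection with the surface and its regularity *)

Section Surface.
Variables (K : fieldType) (U : vectType K).
Notation V := (symp_space U).
Variables (v : V) (x : 'End(V)) (N : nat) (E es : nat -> V) (f fs : V).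
Hypothesis nf : normal_form v x N E es f fs.
Hypotheses (N0 : (0 < N)%N) (xS : in_S x) (dimU : \dim {:U} = N.+1).
Hypothesis dimV : \dim {:V} = N.+1.*2.
Variable k : nat.
Hypothesis kN : (0 < k <= N)%N.
Hypothesis nonroot : forall p : {poly K}, p != 0 -> exists t, p.[t] != 0.
Notation W3 := (K^o * 'rV[K]_2)%type.
Notation fib := (pts (springer_fibre v x)).
Notation Zs := (Zset v x N E es k).
Notation C := (C_var v x (N.+2 - k)).
Notation sfr := (sframe N E es f fs k).
Notation flg A B A' B' := (flag_of_frame (frame (sfr A B A' B'))).

Let sframe_free A B A' B' : dual_params A B A' B' ->
  free (codom (frame (sfr A B A' B'))).
Proof.
move=> dp; rewrite codom_frame; apply: symplectic_frame_free.
exact: (sframe_symplectic nf N0 dimU dimV kN).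
Qed.

(** The two charts cover the surface: if [w.2] vanishes then [w.1] does not. *)
Lemma chart_exists (u : 'rV[K]_2) (w : W3) : u != 0 -> w != 0 -> w.2 \in <[u]>%VS ->
  exists A B A' B', dual_params A B A' B' /\ fits E f fs k u w A B.
Proof.
move=> u0 w0 wu; case: (eqVneq w.2 0) => [w20 | /det2_neq0[d wd]]; last first.
  exists w, (1, 0), (0, d), (- det2 w.2 d, w.1 *: d).
  by split; [exact: chart1_dual | exact: (chart1_fits E f fs k wd wu)].
have [d ud] := det2_neq0 u0.
have w1 : w.1 * det2 u d != 0.
  rewrite mulf_neq0 //; apply: contraNneq w0 => w10.
  by apply/eqP; case: w w10 w20 {wu} => ? ? /= -> ->.
exists (det2 u d * w.1, det2 w.2 d *: u), (0, u), (1, 0), (- det2 w.2 d, w.1 *: d).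
by split; [exact: chart2_dual | exact: (chart2_fits E f fs k w1 wu)].
Qed.

Definition point (F : seq {vspace V}) : {vspace 'rV[K]_2} * {vspace W3} :=
  ((phi f fs @: fl F k.+1)%VS, (psi es f fs k @: fl F k)%VS).

Lemma Zset_point F : Zs F -> exists (u : 'rV[K]_2) (w : W3),
  [/\ u != 0, w != 0, w.2 \in <[u]>%VS & point F = (<[u]>%VS, <[w]>%VS)].
Proof.
move=> ZF; have [u u0 uE] := Zset_phi nf N0 dimU dimV kN ZF.
have [w w0 wE] := Zset_psi nf N0 dimU dimV kN ZF.
exists u, w; split=> //; last by rewrite /point uE wE.
exact: (Zset_incident N0 dimU dimV kN ZF uE wE).
Qed.

Lemma point_sframe (u : 'rV[K]_2) (w A B A' B' : W3) : dual_params A B A' B' ->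
  fits E f fs k u w A B ->
  Zs (flg A B A' B') /\ point (flg A B A' B') = (<[u]>%VS, <[w]>%VS).
Proof.
move=> dp ft; have [ZF uE wE] := sframe_in_Zset nf N0 xS dimU dimV kN dp ft.
by split=> //; rewrite /point uE wE.
Qed.

Lemma sframe_point F (u : 'rV[K]_2) (w A B A' B' : W3) :
  Zs F -> point F = (<[u]>%VS, <[w]>%VS) ->
  dual_params A B A' B' -> fits E f fs k u w A B -> F = flg A B A' B'.
Proof.
by move=> ZF [uE wE] dp ft; apply: (sframe_unique nf N0 dimU dimV kN ZF uE wE).
Qed.

Lemma point_inj F G : Zs F -> Zs G -> point F = point G -> F = G.
Proof.
move=> ZF ZG FG; have [u [w [u0 w0 wu FE]]] := Zset_point ZF.
have [A [B [A' [B' [dp ft]]]]] := chart_exists u0 w0 wu.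
by rewrite (sframe_point ZF FE dp ft) (sframe_point ZG _ dp ft) // -FG.
Qed.

Lemma Zset_closed F : zclosure (springer_fibre v x) C F -> Zs F.
Proof.
move=> FC; have [Ff _] := FC.
have CZ G : C G -> Zs G by apply: (C_sub_Zset nf N0 xS dimU dimV kN).
split=> //.
  move=> a aF; rewrite -lsympE.
  apply: (closure_linear _ FC _ aF); first by rewrite dimV; lia.
  by move=> G b /CZ [_ H _] bG; rewrite lsympE; apply: H.
move=> l a kl aF; rewrite sympC -lsympE.
rewrite (closure_linear (l := lsymp (es l)) _ FC _ aF) ?oppr0 ?dimV //; first by lia.
by move=> G b /CZ [_ _ H] bG; rewrite lsympE sympC (H l) // oppr0.
Qed.

Lemma polymap_fst (W W1 W2 : vectType K) (s : W -> (W1 * W2)%type) :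
  polymap s -> polymap (fun w => (s w).1).
Proof.
move=> ps l.
have L : linear (fun a : (W1 * W2)%type => a.1) by [].
by apply: polyfun_ext (polymap_linear (linfun (fun a : (W1 * W2)%type => a.1)) ps l) => w; rewrite linfunE.
Qed.

Lemma polymap_snd (W W1 W2 : vectType K) (s : W -> (W1 * W2)%type) :
  polymap s -> polymap (fun w => (s w).2).
Proof.
move=> ps l.
have L : linear (fun a : (W1 * W2)%type => a.2) by [].
by apply: polyfun_ext (polymap_linear (linfun (fun a : (W1 * W2)%type => a.2)) ps l) => w; rewrite linfunE.
Qed.

Lemma polyfun_regular (W : vectType K) (s : W -> K^o) : polymap s -> polyfun s.
Proof.
by move=> /(_ \1%VF) ps; apply: polyfun_ext ps => w; rewrite id_lfunE.
Qed.

Lemma regular_polymap (W : vectType K) (s : W -> K) :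
  polyfun s -> polymap (s : W -> K^o).
Proof.
move=> ps l; have H := polyfunM ps (polyfun_cst W (l (1 : K^o) : K)).
apply: polyfun_ext H => w; have -> : s w = s w *: (1 : K^o) :> K^o.
  by rewrite /GRing.scale /= mulr1.
by rewrite linearZ /= {1}/GRing.scale /= mulr1.
Qed.

Lemma polyfun_det2 (W : vectType K) (s t : W -> 'rV[K]_2) :
  polymap s -> polymap t -> polyfun (fun w => det2 (s w) (t w)).
Proof.
move=> ps pt; rewrite /det2.
by apply: polyfunD; [|apply: polyfunN]; apply: polyfunM; apply: polyfun_entry.
Qed.

Lemma polymap_pw (W : vectType K) g (A : W -> W3) :
  polymap A -> polymap (fun w => pw g f fs k (A w)).
Proof.
move=> pA; apply: polymapD.
  by apply: polymapZ (polymap_cst _ _); apply: polyfun_regular; apply: polymap_fst.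
by apply: polymapD; apply: polymapZ (polymap_cst _ _);
  apply: polyfun_entry; apply: polymap_snd.
Qed.

Lemma polymap_half (W : vectType K) g (A B : W -> V) i :
  polymap A -> polymap B -> polymap (fun w => lag_half k g (A w) (B w) i).
Proof.
move=> pA pB; rewrite /lag_half; case: (i.+1 < k)%N; first exact: polymap_cst.
case: (i.+1 == k) => //; case: (i == k) => //; exact: polymap_cst.
Qed.

Lemma polymap_sframe (W : vectType K) (A B A' B' : W -> W3) :
  polymap A -> polymap B -> polymap A' -> polymap B' ->
  polymap (fun w => frame (sfr (A w) (B w) (A' w) (B' w))).
Proof.
move=> pA pB pA' pB'; apply: polymap_ffun => i; rewrite /sframe.
by case: (i < N.+1)%N; apply: polymap_half; apply: polymap_pw.
Qed.

Lemma flg_scale a b a' b' A B A' B' : a != 0 -> b != 0 -> a' != 0 -> b' != 0 ->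
  flg (a *: A) (b *: B) (a' *: A') (b' *: B') = flg A B A' B'.
Proof.
move=> a0 b0 a0' b0'.
pose c (p q : K) i := if (i.+1 < k)%N then 1 else if i.+1 == k then p else
  if i == k then q else 1.
apply: (@frame_scale _ _ _ _ (fun i => if (i < N.+1)%N then c a b i else
  c a' b' (N.*2.+1 - i)%N)) => i.
  by rewrite /c; do !case: ifP => _; rewrite ?oner_eq0.
rewrite /sframe /c; case: (i < N.+1)%N; rewrite /lag_half.
  case: (i.+1 < k)%N; first by rewrite scale1r.
  case: (i.+1 == k); first exact: pwZ.
  by case: (i == k); [exact: pwZ | rewrite scale1r].
case: (_ < k)%N; first by rewrite scale1r.
case: (_ == k); first exact: (pwZ es).
by case: (_ == k); [exact: (pwZ es) | rewrite scale1r].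
Qed.

Lemma Zset_dense F : Zs F -> zclosure (springer_fibre v x) C F.
Proof.
move=> ZF; have [Ff _ _] := ZF; split=> // B oB BF.
have [u [w [u0 w0 wu FE]]] := Zset_point ZF.
have inC G (w' : W3) : Zs G -> point G = (<[u]>%VS, <[w']>%VS) ->
    w'.2 \in <[u]>%VS -> w'.2 != 0 -> C G.
  move=> ZG GE wu' /det2_neq0[d wd].
  rewrite (sframe_point ZG GE (chart1_dual wd) (chart1_fits E f fs k wd wu')).
  exact: (chart1_in_C nf N0 xS dimU dimV kN).
case: (eqVneq w.2 0) => [w20 | w20]; last by exists F => //; apply: (inC F w).
have [d ud] := det2_neq0 u0.
have w1 : w.1 * det2 u d != 0.
  rewrite mulf_neq0 //; apply: contraNneq w0 => w10.
  by apply/eqP; case: w w10 w20 {wu FE} => ? ? /= -> ->.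
have [B1 oB1 BE] := oB; have [B1p [O oO OE]] := oB1.
(* A curve in the fibre over [u] passing through w at t = 0; for t nonzero its flags lie in C. The
   second chart lifts it polynomially to frames. *)
pose wt (t : K^o) : W3 := (w.1, t *: u).
have wtu t : (wt t).2 \in <[u]>%VS by rewrite memvZ ?memv_line.
pose e (t : K^o) := frame (sfr (det2 u d * w.1, det2 (t *: u) d *: u) (0, u) (1, 0)
  (- det2 (t *: u) d, w.1 *: d)).
have dp t := @chart2_dual K u (wt t) d w1.
have ft t := @chart2_fits K U E f fs k u (wt t) d w1 (wtu t).
have Oe t : O (e t) <-> B1 (flag_of_frame (e t)).
  have fe : free (codom (e t)) by apply: sframe_free; apply: (dp t).
  have -> : O (e t) = (O `&` [set e0 | free (codom e0)]) (e t).
    by apply/propext; split=> [? | []].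
  by rewrite -OE; split=> [[] | ].
have wt0 : wt 0 = w.
  by rewrite /wt scale0r; case: (w) w20 => ? ? /= ->.
have F0 : F = flag_of_frame (e 0).
  by apply: (sframe_point ZF _ (dp 0) (ft 0)); rewrite wt0.
have Oe0 : O (e 0) by apply/Oe; rewrite -F0; move: BF; rewrite BE => -[].
have [q pq [qe qO]] := (affine_openP O).1 oO _ Oe0.
have ptu : polymap (fun t : K^o => t *: u : 'rV[K]_2).
  apply: polymapZ; last exact: polymap_cst.
  by apply: polyfun_regular; apply: polymap_id.
have pdet : polyfun (fun t : K^o => det2 (t *: u) d).
  by apply: polyfun_det2 => //; apply: polymap_cst.
have pe : polymap e.
  apply: polymap_sframe; try exact: polymap_cst.
    apply: polymap_pair; first exact: polymap_cst.
    by apply: polymapZ => //; apply: polymap_cst.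
  apply: polymap_pair; last exact: polymap_cst.
  by apply: regular_polymap; apply: polyfunN.
have [p pE] := polyfun_line (polyfun_comp pq pe).
have p0 : p != 0.
  by apply: contraNneq qe => p0; rewrite pE p0 horner0.
(* The factor 'X secures t nonzero along with the open condition. *)
have [t] : exists t, (p * 'X).[t] != 0.
  by apply: nonroot; rewrite mulf_neq0 // polyX_eq0.
rewrite hornerM hornerX mulf_eq0 negb_or -pE => /andP[qt t0].
have [ZG GE] := point_sframe (dp t) (ft t).
exists (flag_of_frame (e t)).
  rewrite BE; split; first by apply/Oe; apply: qO.
  by case: ZG => -[].
apply: (inC _ (wt t)) => //.
by rewrite /wt /= scaler_eq0 negb_or t0.
Qed.

Lemma expand_eq0 a : (forall l, symp a (es l.+1) = 0) ->
  (forall l, (l <= N)%N -> symp (E l) a = 0) -> phi f fs a = 0 -> a = 0.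
Proof.
move=> aes aE pa; rewrite (nf_expand nf a) -addrA -pf_phi pa /pf !mxE !scale0r !addr0.
by rewrite big1 // => i _; rewrite aes aE ?scale0r ?addr0.
Qed.

Lemma pairZ (c : K) (p1 : K) (p2 : 'rV[K]_2) :
  c *: ((p1, p2) : W3) = (c * p1, c *: p2) :> W3.
Proof. by []. Qed.

(** Homogeneity of the second chart; with [flg_scale] it makes the flag depend only on the two
    lines. *)
Lemma chart2_scale a b (u : 'rV[K]_2) (w : W3) d :
  let A u (w : W3) : W3 := (det2 u d * w.1, det2 w.2 d *: u) in
  let B' (w : W3) : W3 := (- det2 w.2 d, w.1 *: d) in
  [/\ A (a *: u) (b *: w) = (a * b) *: A u w,
      (0, a *: u) = a *: ((0, u) : W3) & B' (b *: w) = b *: B' w].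
Proof.
case: w => w1 w2 /=; rewrite !pairZ !det2Zl !mulr0 -[b *: w1]/(b * w1) !scalerA.
have cA : a * det2 u d * (b * w1) = a * b * (det2 u d * w1) by ring.
have -> : b * det2 w2 d * a = a * b * det2 w2 d by ring.
by rewrite cA mulrN.
Qed.

Section Regular.
Variable Z : set (seq {vspace V}).
Let X := sub_variety (flag_variety V) Z.
Hypothesis XZ : forall F, pts X F <-> Zs F.

Let nthc (e : {ffun 'I_(\dim {:V}) -> V}) j := nth 0 (codom e) j.

Let flE e j : (j <= \dim {:V})%N ->
  fl (flag_of_frame e) j = <<mkseq (nthc e) j>>%VS.
Proof. by move=> jV; rewrite {1}(frame_codom e) fl_frame. Qed.

Let free_nthc (e : {ffun 'I_(\dim {:V}) -> V}) j :
  free (codom e) -> (j <= \dim {:V})%N -> free (mkseq (nthc e) j).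
Proof.
move=> fe jV; have : codom e = mkseq (nthc e) (\dim {:V}).
  by rewrite {1}(frame_codom e) codom_frame.
move=> ce; move: fe; rewrite ce -(cat_take_drop j (mkseq _ _)) => /catl_free.
by rewrite take_mkseq.
Qed.

(** Up to sign, the coordinate along E_{i+1}. *)
Let t i := lsymp (es i.+1).

Lemma point_regular : regular_map X (Sigma_neg K 1) point.
Proof.
apply: (@regular_map_lift K _ ('rV[K]_2 * W3)%type _ _
  [set e : {ffun 'I_(\dim {:V}) -> V} | free (codom e)] (@flag_of_frame K V) Z
  [set w : ('rV[K]_2 * W3)%type | w.1 != 0 /\ w.2 != 0]
  (fun w => (<[w.1]>%VS, <[w.2]>%VS))) => F XF.
  have /Zset_point[u [w [u0 w0 wu ->]]] := (XZ F).1 XF.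
  by apply/SigmaP; exists u, w.
have ZF := (XZ F).1 XF; have [Ff _ Fes] := ZF.
have [u [w [u0 w0 wu [uE wE]]]] := Zset_point ZF.
(* Applied to the images of the minor vectors, these give the function d of the local lift; it
   detects that both images are nonzero. *)
have [l1 l1u] := functional_neq0 u0; have [l2 l2w] := functional_neq0 w0.
have k1V : (k.+1 <= \dim {:V})%N by rewrite dimV; lia.
have kV : (k <= \dim {:V})%N by rewrite dimV; lia.
have k0 : (0 < k)%N by lia.
pose s e : ('rV[K]_2 * W3)%type := (phi f fs (minor_vec t k (nthc e)),
  psi es f fs k (minor_vec t k.-1 (nthc e))).
have ps1 : polymap (fun e => (s e).1).
  by apply: polymap_linear; apply: polymap_minor_vec => j; apply: polymap_nth_codom.
have ps2 : polymap (fun e => (s e).2).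
  by apply: polymap_linear; apply: polymap_minor_vec => j; apply: polymap_nth_codom.
exists s, (fun e => l1 (s e).1 * l2 (s e).2); split.
  have nz e : l1 (s e).1 * l2 (s e).2 != 0 -> (s e).1 != 0 /\ (s e).2 != 0.
    rewrite mulf_eq0 negb_or => /andP[n1 n2].
    split; [apply: contraNneq n1 => -> | apply: contraNneq n2 => ->];
      by rewrite linear0.
  split.
  - exact: polymap_pair.
  - by apply: polyfunM; [apply: ps1 | apply: ps2].
  - by move=> e _ /nz.
  - move=> e1 e2 f1 f2 e12 d1; have [n1 n2] := nz _ d1.
    have sp j : (j <= \dim {:V})%N -> <<mkseq (nthc e1) j>>%VS = <<mkseq (nthc e2) j>>%VS.
      by move=> jV; rewrite -!flE // e12.
    have [c c0 cE] : exists2 c, c != 0 & (s e2).1 = c *: (s e1).1.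
      have [c c0 cE] := minor_vec_flag t (free_nthc f1 k1V) (free_nthc f2 k1V) isT (sp _ k1V).
      have {}cE : minor_vec t k (nthc e2) = c *: minor_vec t k (nthc e1) := cE.
      by exists c; rewrite // /s /= cE linearZ.
    have [c' c0' cE'] : exists2 c, c != 0 & (s e2).2 = c *: (s e1).2.
      have [c' c0' cE'] := minor_vec_flag t (free_nthc f1 kV) (free_nthc f2 kV) k0 (sp _ kV).
      by exists c'; rewrite // /s /= cE' linearZ.
    case: (s e2) cE cE' => q1 q2 /= -> ->.
    rewrite (line_scaleE _ c0) (line_scaleE _ c0'); split; last by [].
    move: d1; rewrite mulf_eq0 negb_or => /andP[m1 m2].
    by apply: mulf_neq0; rewrite linearZ; apply: mulf_neq0.
  - move=> e fe /XZ ZG /nz [n1 n2].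
    have [u' [w' [_ _ _ [uE' wE']]]] := Zset_point ZG.
    have m1 : minor_vec t k (nthc e) \in fl (flag_of_frame e) k.+1.
      by rewrite (flE _ k1V); apply: minor_vec_span.
    have m2 : minor_vec t k.-1 (nthc e) \in fl (flag_of_frame e) k.
      by rewrite (flE _ kV) -{2}(prednK k0); apply: minor_vec_span.
    rewrite /point uE' wE'; congr (_, _); apply: line_eq => //.
      by rewrite -uE'; apply: memv_img.
    by rewrite -wE'; apply: memv_img.
have [[e [_ fe] eF] _] := XF.
exists e; split=> //.
have Fk a : a \in fl F k -> a \in fl F k.+1.
  by apply: (subvP (fib_sub dimV Ff _)); lia.
have aE a l : a \in fl F k.+1 -> (l <= N)%N -> symp (E l) a = 0.
  move=> aF lN; apply: (fib_E_perp nf N0 dimU dimV kN Ff lN).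
  by apply: (subvP (fib_sub dimV Ff _)) aF; lia.
have tE i a : t i a = 0 -> symp a (es i.+1) = 0.
  by rewrite lsympE => ta; rewrite sympC ta oppr0.
rewrite mulf_neq0 //.
  rewrite -[l1 _](comp_lfunE l1 (phi f fs)) minor_vec_det.
  (* A vector of F_{k+1} killed by t_0 .. t_{k-1} has no E-component, and [l1] is nonzero on the
     line of its [phi]-image; killed by [l1] too, it is zero. *)
  apply: minor_mx_det_neq0; first exact: free_nthc.
  rewrite -flE // eF => a aF ta; rewrite comp_lfunE => la.
  have /vlineP[c cE] : phi f fs a \in <[u]>%VS by rewrite -uE memv_img.
  apply: expand_eq0 => [l | l lN |].
  - case: (ltnP l k) => lk; first by apply: tE; apply: ta.
    by apply: Fes.
  - exact: aE.
  - move: la; rewrite cE linearZ /= => /eqP; rewrite mulf_eq0 (negPf l1u) orbF.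
    by move=> /eqP ->; rewrite scale0r.
rewrite -[l2 _](comp_lfunE l2 (psi es f fs k)) minor_vec_det.
apply: minor_mx_det_neq0; first by rewrite prednK //; apply: free_nthc.
rewrite prednK // -flE // eF => a aF ta; rewrite comp_lfunE => la.
have /vlineP[c cE] : psi es f fs k a \in <[w]>%VS by rewrite -wE memv_img.
have : psi es f fs k a = 0.
  move: la; rewrite cE linearZ /= => /eqP; rewrite mulf_eq0 (negPf l2w) orbF.
  by move=> /eqP ->; rewrite scale0r.
rewrite psiE => -[ak pa]; apply: expand_eq0 => [l | l lN | //].
- case: (ltngtP l.+1 k) => lk; [|by apply: Fes => //; apply: Fk | by rewrite lk].
  by apply: tE; apply: ta; lia.
- by apply: aE => //; apply: Fk.
Qed.

(** Chosen globally; the explicit chart frames enter only to show existence and local regularity. *)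
Definition point_inv (l : {vspace 'rV[K]_2} * {vspace W3}) : seq {vspace V} :=
  xget [::] [set F | Zs F /\ point F = l].

Lemma point_invP l : pts (Sigma_neg K 1) l ->
  Zs (point_inv l) /\ point (point_inv l) = l.
Proof.
move=> /SigmaP[u [w [u0 w0 wu lE]]].
have [A [B [A' [B' [dp ft]]]]] := chart_exists u0 w0 wu.
rewrite /point_inv; case: xgetP => [F -> // | /(_ (flg A B A' B'))].
by rewrite lE => -[]; apply: point_sframe.
Qed.

Lemma point_inv_regular : regular_map (Sigma_neg K 1) X point_inv.
Proof.
apply: (@regular_map_lift K ('rV[K]_2 * W3)%type _ _ _
  [set w : ('rV[K]_2 * W3)%type | w.1 != 0 /\ w.2 != 0]
  (fun w => (<[w.1]>%VS, <[w.2]>%VS)) _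
  [set e : {ffun 'I_(\dim {:V}) -> V} | free (codom e)] (@flag_of_frame K V) Z) => l Sl.
  by apply/XZ; case: (point_invP Sl).
have [u [w [u0 w0 wu lE]]] := (SigmaP l).1 Sl.
have pu : polymap (fun uw : ('rV[K]_2 * W3)%type => uw.1).
  by apply: polymap_fst; apply: polymap_id.
have pw2 : polymap (fun uw : ('rV[K]_2 * W3)%type => uw.2).
  by apply: polymap_snd; apply: polymap_id.
have pw21 : polyfun (fun uw : ('rV[K]_2 * W3)%type => uw.2.1).
  by apply: polyfun_regular; apply: polymap_fst.
have pw22 : polymap (fun uw : ('rV[K]_2 * W3)%type => uw.2.2).
  exact: polymap_snd.
have compat uw A B A' B' : uw.1 != 0 /\ uw.2 != 0 ->
    pts (Sigma_neg K 1) (<[uw.1]>%VS, <[uw.2]>%VS) -> dual_params A B A' B' ->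
    (uw.2.2 \in <[uw.1]>%VS -> fits E f fs k uw.1 uw.2 A B) ->
    flg A B A' B' = point_inv (<[uw.1]>%VS, <[uw.2]>%VS).
  move=> [n1 n2] Suw dp ft; have [ZF FE] := point_invP Suw.
  have wu' : uw.2.2 \in <[uw.1]>%VS.
    have [_ [u' u'0 /= [-> wE]]] := Suw.
    by rewrite -bundle_fibreP.
  by apply/esym/(sframe_point ZF FE dp)/ft.
have lineP (p q : ('rV[K]_2 * W3)%type) : p.1 != 0 /\ p.2 != 0 ->
    (<[p.1]>%VS, <[p.2]>%VS) = (<[q.1]>%VS, <[q.2]>%VS) ->
    exists a b, [/\ a != 0, b != 0, q.1 = a *: p.1 & q.2 = b *: p.2].
  move=> [n1 n2] pq; have e1 : <[p.1]>%VS = <[q.1]>%VS := congr1 fst pq.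
  have e2 : <[p.2]>%VS = <[q.2]>%VS := congr1 snd pq.
  have [a a0 aE] := line_scale n1 e1.
  by have [b b0 bE] := line_scale n2 e2; exists a, b.
have ppw21 := regular_polymap pw21.
(* The second chart serves the points with [w.2] zero, the first all others. *)
case: (eqVneq w.2 0) => [w20 | /det2_neq0[d wd]].
  have [d ud] := det2_neq0 u0.
  have w1 : w.1 * det2 u d != 0.
    rewrite mulf_neq0 //; apply: contraNneq w0 => w10.
    by apply/eqP; case: w w10 w20 {wu lE} => ? ? /= -> ->.
  pose s (uw : ('rV[K]_2 * W3)%type) :=
    frame (sfr (det2 uw.1 d * uw.2.1, det2 uw.2.2 d *: uw.1) (0, uw.1) (1, 0)
      (- det2 uw.2.2 d, uw.2.1 *: d)).
  have pd1 : polyfun (fun uw : ('rV[K]_2 * W3)%type => det2 uw.1 d).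
    by apply: polyfun_det2 => //; apply: polymap_cst.
  have pd2 : polyfun (fun uw : ('rV[K]_2 * W3)%type => det2 uw.2.2 d).
    by apply: polyfun_det2 => //; apply: polymap_cst.
  exists s, (fun uw => uw.2.1 * det2 uw.1 d); split; last by exists (u, w).
  split.
  - apply: polymap_sframe.
    + apply: polymap_pair; last exact: polymapZ.
      by apply: regular_polymap; apply: polyfunM.
    + by apply: polymap_pair => //; apply: polymap_cst.
    + exact: polymap_cst.
    + apply: polymap_pair; first by apply: regular_polymap; apply: polyfunN.
      by apply: polymapZ => //; apply: polymap_cst.
  - exact: polyfunM.
  - by move=> uw _ D; apply: sframe_free; apply: chart2_dual.
  - move=> p q np _ pq; have [a [b [a0 b0 qa qb]]] := lineP p q np pq.
    rewrite qa qb /= => D; split.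
      rewrite det2Zl /GRing.scale /=.
      by move: D; rewrite !mulf_eq0 (negPf a0) (negPf b0).
    have [eA eB eB'] := chart2_scale a b p.1 p.2 d.
    rewrite /s qa qb eA eB eB' -[in RHS](scale1r (1, 0)).
    by apply/esym/flg_scale => //; [exact: mulf_neq0 | exact: oner_neq0].
  - move=> uw n Suw D; apply: compat => //; first exact: chart2_dual.
    exact: chart2_fits.
pose s (uw : ('rV[K]_2 * W3)%type) :=
  frame (sfr uw.2 (1, 0) (0, d) (- det2 uw.2.2 d, uw.2.1 *: d)).
have pd2 : polyfun (fun uw : ('rV[K]_2 * W3)%type => det2 uw.2.2 d).
  by apply: polyfun_det2 => //; apply: polymap_cst.
exists s, (fun uw => det2 uw.2.2 d); split; last by exists (u, w).
split.
- apply: polymap_sframe => //; try exact: polymap_cst.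
  apply: polymap_pair; first by apply: regular_polymap; apply: polyfunN.
  by apply: polymapZ => //; apply: polymap_cst.
- exact: pd2.
- by move=> uw _ D; apply: sframe_free; apply: chart1_dual.
- move=> p q np _ pq; have [a [b [a0 b0 qa qb]]] := lineP p q np pq.
  rewrite qb /= => D; split.
    by rewrite det2Zl mulf_neq0.
  have [_ _ eB'] := chart2_scale b b p.1 p.2 d.
  rewrite /s qb eB' -[in RHS](scale1r (1, 0)).
  rewrite -[in RHS](scale1r (0, d)).
  by apply/esym/flg_scale => //; exact: oner_neq0.
- move=> uw n Suw D; apply: compat => //; first exact: chart1_dual.
  exact: (chart1_fits E f fs k D).
Qed.

End Regular.

Lemma closure_isomorphic : isomorphic
  (sub_variety (springer_fibre v x) (zclosure (springer_fibre v x) C))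
  (Sigma_neg K 1).
Proof.
(* Naming the defining set lets the nested subvarieties be flattened to one subvariety of the flag
   variety. *)
have [Z1 spE] : exists Z1, springer_fibre v x = sub_variety (flag_variety V) Z1.
  by rewrite /springer_fibre; eexists.
set Z2 := zclosure _ _; set Y := sub_variety _ _.
have YZ F : pts Y F <-> Zs F.
  split=> [[_ /Zset_closed] // | ZF]; split; first by case: ZF.
  exact: Zset_dense.
have XZ F : pts (sub_variety (flag_variety V) (Z1 `&` Z2)) F <-> Zs F.
  rewrite -YZ /Y spE; split=> [[FV [F1 F2]] | [[FV F1] F2]]; split=> //.
have Qp B : zopen (flag_variety V) B -> B `<=` pts (flag_variety V) by case.
have Qr : restrictable (flag_variety V).
  by apply: quotient_restrictable; apply: sub_restrictable; apply: affine_restrictable.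
exists point, point_inv; split.
- rewrite -[point]/(point \o id); apply: regular_map_comp (point_regular XZ).
  by rewrite /Y spE; apply: sub_sub_regular.
- rewrite -[point_inv]/(id \o point_inv); apply: regular_map_comp (point_inv_regular XZ) _.
  by rewrite /Y spE; apply: sub_regular_sub.
- move=> F /YZ ZF; have [u [w [u0 w0 wu FE]]] := Zset_point ZF.
  have [ZG GE] : Zs (point_inv (point F)) /\ point (point_inv (point F)) = point F.
    by apply: point_invP; apply/SigmaP; exists u, w.
  exact: point_inj.
- by move=> l /point_invP[].
Qed.

End Surface.

Lemma nonroot_exists (K : numDomainType) (p : {poly K}) :
  p != 0 -> exists t, p.[t] != 0.
Proof.
move=> p0; apply: contrapT => H.
have : (size [seq j%:R : K | j <- iota 0 (size p)] < size p)%N.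
  apply: max_poly_roots => //.
    apply/allP => t _; apply/negP => /negP pt; apply: H.
    by exists t.
  by rewrite map_inj_uniq ?iota_uniq // => a b /eqP; rewrite eqr_nat => /eqP.
by rewrite size_map size_iota ltnn.
Qed.

Theorem proposition8p6 (R : realType) (n : nat) (U : vectType R[i])
    (v : symp_space U) (x : 'End(symp_space U)) (i : nat) :
  (2 <= n)%N -> \dim {:U} = n ->
  exotic_nilcone (v, x) ->
  eType (@symp _ U) v x ([:: n.-1; 1%N], [::]) ->
  (2 <= i <= n)%N ->
  isomorphic
    (sub_variety (springer_fibre v x)
       (zclosure (springer_fibre v x) (C_var v x i)))
    (Sigma_neg R[i] 1).
Proof.
case: n => [|N] // N0 dimU [/= xS _] et /andP[i2 iN].
have [dimV [E [es [f [fs nf]]]]] := normal_form_exists N0 et.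
have kN : (0 < N.+2 - i <= N)%N by lia.
have := closure_isomorphic nf N0 xS dimU dimV kN (@nonroot_exists _).
by rewrite subKn //; lia.
Qed.
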